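(* For all $B, D > 0$ there exist $K, \epsilon_0, R_0 > 0$ such that for all $R > R_0$ and $\epsilon < \epsilon_0$ the following holds. Let $(\gamma_i)_{i=0}^n$ be a linear sequence of geodesics in $\mathbb{H}^2 \subset \mathbb{H}^3$ and $(\gamma'_i)_{i=0}^n$ a semi-linear sequence of oriented geodesics in $\mathbb{H}^3$ which are $(R, B, \epsilon)$-well-matched. Then the map $e\colon \mathcal{F}(\gamma_0) \cup \mathcal{F}(\gamma_n) \to \mathcal{F}(\gamma'_0)\cup\mathcal{F}(\gamma'_n)$ has $K\epsilon$-bounded distortion at distance $D$.
   Context: Frames: $\mathcal{F}\mathbb{H}^3$ is the bundle of positively oriented orthonormal 3-frames. Fixing a base frame identifies $\mathcal{F}\mathbb{H}^3$ with the group $G$ of orientation-preserving isometries of $\mathbb{H}^3$; for frames $u,v$ let $u\to v = u^{-1}v\in G$ (so $u\cdot(u\to v)=v$). Fix a left-invariant Riemannian metric $d$ on $G$, write $d(g)=d(1,g)$ and $d(u,v) = d(u\to v)$. For an oriented geodesic $\gamma$ and a unit normal $v$ to $\gamma$, the associated frame is $(q,w,v)$ where $w$ is the positive unit tangent to $\gamma$ and $q$ completes $(w,v)$ to a positive frame; $\mathcal{F}(\gamma)$ is the set of all such frames. A map $\tilde e\colon X\to\mathcal{F}\mathbb{H}^3$ ($X\subset\mathcal{F}\mathbb{H}^3$) has $\epsilon$-bounded distortion to distance $D$ if $d(u\to v,\tilde e(u)\to\tilde e(v))<\epsilon$ whenever $u,v\in X$ and $d(u,v)<D$. Linear sequence: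 $(\gamma_i)$ pairwise disjoint geodesics in $\mathbb{H}^2$ with consecutive common orthogonals, each separating its predecessors from its successors, each oriented so that its successors lie to its left. Semi-linear sequence: oriented geodesics $(\gamma'_i)$ in $\mathbb{H}^3$ with each consecutive pair disjoint with a common orthogonal. Let $\eta_i$ (resp. $\eta'_i$) be the common orthogonal of $\gamma_i,\gamma_{i+1}$ (resp. $\gamma'_i,\gamma'_{i+1}$); $u_i$ (resp. $u'_i$) the complex distance between $\gamma_i$ and $\gamma_{i+1}$ (length of the orthogonal plus $i$ times the twist angle; $u_i$ is real positive); $v_i$ (resp. $v'_i$) the complex distance along $\gamma_i$ (resp. $\gamma'_i$) from $\eta_{i-1}$ to $\eta_i$ (signed translation plus $i$ times rotation; $v_i$ is real). The map $e$ is defined on $\mathcal{F}(\gamma_0)$ as the restriction of the orientation-preserving isometry of $\mathbb{H}^3$ taking oriented $\gamma_0$ to oriented $\gamma'_0$ and the inward unit tangent of $\eta_0$ at $\gamma_0$ to that of $\eta'_0$ at $\gamma'_0$, and on $\mathcal{F}(\gamma_n)$ likewise using the feet of $\eta_{n-1}$ and $\eta'_{n-1}$ on $\gamma_n$, $\gamma'_n$. The sequences are $(R,B,\epsilon)$-well-matched if for every index $i$ for which the quantities are defined: $v_i = 1$; $|v'_i - v_i| < \epsilon/R$; $B^{-1} < u_i e^{R/2} < B$; and $|u'_i - u_i| < \epsilon |u_i|$. *)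

(* Defs.v *)
From HB Require Import structures.
From mathcomp Require Import all_boot all_order all_algebra.
From mathcomp Require Import all_classical all_reals all_analysis.
Set Implicit Arguments. Unset Strict Implicit. Unset Printing Implicit Defensive.
Import Order.TTheory GRing.Theory Num.Theory.
Import numFieldNormedType.Exports.
Local Open Scope classical_set_scope.
Local Open Scope ring_scope.

Section Hyperbolic.
Variable R : realType.

Definition i0 : 'I_4 := inord 0.
Definition i1 : 'I_4 := inord 1.
Definition i2 : 'I_4 := inord 2.
Definition i3 : 'I_4 := inord 3.

Definition vec := 'cV[R]_4.
Definition mink (x y : vec) : R :=
  x i0 0 * y i0 0 + x i1 0 * y i1 0 + x i2 0 * y i2 0 - x i3 0 * y i3 0.
Definition Jmx : 'M[R]_4 := \matrix_(i, j) (if i == j then (if i == i3 then -1 else 1) else 0).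

(* hyperboloid model of H^3 *)
Definition hpt (x : vec) : Prop := mink x x = -1 /\ 0 < x i3 0.
Definition in_H2 (x : vec) : Prop := hpt x /\ x i2 0 = 0.

Definition cosh (t : R) : R := (expR t + expR (- t)) / 2.
Definition sinh (t : R) : R := (expR t - expR (- t)) / 2.

Definition isomG (F : 'M[R]_4) : Prop :=
  F^T *m Jmx *m F = Jmx /\ \det F = 1 /\ 0 < F i3 i3.

(* Frames.  Fixing the base frame (e_0,e_1,e_2 at the point e_3) identifies a
   positively oriented orthonormal frame (q,w,v) at p with the element F of G
   whose columns are (q, w, v, p). *)
Definition frame_pt (F : 'M[R]_4) : vec := col i3 F.
Definition frame_q (F : 'M[R]_4) : vec := col i0 F.
Definition frame_w (F : 'M[R]_4) : vec := col i1 F.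
Definition frame_v (F : 'M[R]_4) : vec := col i2 F.

Definition arr (u v : 'M[R]_4) : 'M[R]_4 := invmx u *m v.

(* boost along the spatial axis k (translation along the geodesic tangent to e_k at e_3) *)
Definition boost (k : 'I_4) (t : R) : 'M[R]_4 :=
  \matrix_(i, j)
    (if ((i == k) && (j == k)) || ((i == i3) && (j == i3)) then cosh t
     else if ((i == k) && (j == i3)) || ((i == i3) && (j == k)) then sinh t
     else if i == j then 1 else 0).
Definition rot (a b : 'I_4) (th : R) : 'M[R]_4 :=
  \matrix_(i, j)
    (if ((i == a) && (j == a)) || ((i == b) && (j == b)) then cos th
     else if (i == b) && (j == a) then sin th
     else if (i == a) && (j == b) then - sin th
     else if i == j then 1 else 0).

(* an oriented geodesic is given by a point p and a positive unit tangent w at p;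
   it is the curve t |-> cosh t p + sinh t w *)
Record ogeod := OGeod { gp : vec; gw : vec }.
Definition valid_geod (g : ogeod) : Prop :=
  hpt (gp g) /\ mink (gw g) (gw g) = 1 /\ mink (gp g) (gw g) = 0.
Definition gpt (g : ogeod) (t : R) : vec := cosh t *: gp g + sinh t *: gw g.
Definition gtan (g : ogeod) (t : R) : vec := sinh t *: gp g + cosh t *: gw g.
Definition on_geod (g : ogeod) (x : vec) : Prop := exists t, x = gpt g t.
Definition disjoint_geod (g h : ogeod) : Prop := forall x, on_geod g x -> ~ on_geod h x.

Definition Fr (g : ogeod) : set 'M[R]_4 :=
  [set F | isomG F /\ exists t, frame_pt F = gpt g t /\ frame_w F = gtan g t].

Definition common_orth (g h eta : ogeod) : Prop :=
  valid_geod eta /\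
  (exists t, gp eta = gpt g t /\ mink (gw eta) (gtan g t) = 0) /\
  (exists l, 0 < l /\ exists s, gpt eta l = gpt h s /\ mink (gtan eta l) (gtan h s) = 0).

Definition out_frame (g eta : ogeod) (F : 'M[R]_4) : Prop :=
  Fr g F /\ frame_pt F = gp eta /\ frame_v F = gw eta.
Definition in_frame (h eta : ogeod) (F : 'M[R]_4) : Prop :=
  Fr h F /\ exists l, frame_pt F = gpt eta l /\ frame_v F = gtan eta l.

Definition sel3 (k : 'I_3) : 'I_4 := if val k == 2%N then i3 else inord (val k).
(* sign of this determinant: x lies to the left (>0) or right (<0) of g inside H^2,
   for the orientation of H^2 given by the coordinates (x_0, x_1) *)
Definition side (g : ogeod) (x : vec) : R :=
  \det (\matrix_(i < 3, j < 3)
         (if val j == 0%N then gp g (sel3 i) 0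
          else if val j == 1%N then gw g (sel3 i) 0 else x (sel3 i) 0)).

Definition geod_in_H2 (g : ogeod) : Prop :=
  valid_geod g /\ gp g i2 0 = 0 /\ gw g i2 0 = 0.

Definition linear_seq (n : nat) (gam eta : nat -> ogeod) : Prop :=
  (forall i, (i <= n)%N -> geod_in_H2 (gam i)) /\
  (forall i j, (i < j <= n)%N -> disjoint_geod (gam i) (gam j)) /\
  (forall i, (i < n)%N -> common_orth (gam i) (gam i.+1) (eta i)) /\
  (forall i j, (i <= n)%N -> (j <= n)%N -> (i < j)%N ->
     forall x, on_geod (gam j) x -> 0 < side (gam i) x) /\
  (forall i j, (i <= n)%N -> (j <= n)%N -> (j < i)%N ->
     forall x, on_geod (gam j) x -> side (gam i) x < 0).

Definition semilinear_seq (n : nat) (gam eta : nat -> ogeod) : Prop :=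
  (forall i, (i <= n)%N -> valid_geod (gam i)) /\
  (forall i, (i < n)%N -> disjoint_geod (gam i) (gam i.+1) /\
                          common_orth (gam i) (gam i.+1) (eta i)).

Definition orth_frames (n : nat) (gam eta : nat -> ogeod) (Fo Fi : nat -> 'M[R]_4) :=
  forall i, (i < n)%N -> out_frame (gam i) (eta i) (Fo i) /\ in_frame (gam i.+1) (eta i) (Fi i.+1).

Definition cabs (a b : R) : R := Num.sqrt (a ^+ 2 + b ^+ 2).

(* complex distances: the complex distance from gam_i to gam_{i+1} is l + i th where
   Fi (i+1) = Fo i * boost_v(l) * rot_{q,w}(th) (defined modulo 2 pi i); the complex
   distance along gam_i from eta_{i-1} to eta_i is t + i th where
   Fo i = Fi i * boost_w(t) * rot_{q,v}(th).  For the linear sequence the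
   imaginary parts are 0, and u_i, v_i are the real numbers below. *)
Definition well_matched (RR B eps : R) (n : nat) (Fo Fi Fo' Fi' : nat -> 'M[R]_4) : Prop :=
  (forall i, (0 < i < n)%N ->
     (* v_i = 1 *)
     Fo i = Fi i *m boost i1 1 /\
     exists t th, Fo' i = Fi' i *m boost i1 t *m rot i0 i2 th /\
                  cabs (t - 1) th < eps / RR) /\
  (forall i, (i < n)%N ->
     exists l, Fi i.+1 = Fo i *m boost i2 l /\
       (* B^-1 < u_i e^{R/2} < B *)
       B^-1 < l * expR (RR / 2) < B /\
       exists l' th', Fi' i.+1 = Fo' i *m boost i2 l' *m rot i0 i1 th' /\
                      cabs (l' - l) th' < eps * l).

Definition emap (g0 : ogeod) (F0 F0' Fn Fn' : 'M[R]_4) (x : 'M[R]_4) : 'M[R]_4 :=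
  if `[< Fr g0 x >] then (F0' *m invmx F0) *m x else (Fn' *m invmx Fn) *m x.

(* A left-invariant Riemannian metric on G is given by an inner product on the Lie
   algebra; every such is the restriction of an inner product on M_4(R), and every
   inner product on M_4(R) = R^16 is X,Y |-> <mxvec X *m A, mxvec Y *m A> for some
   invertible A. *)
Definition lnorm (A : 'M[R]_16) (X : 'M[R]_4) : R :=
  Num.sqrt (\sum_(j < 16) ((mxvec X *m A) 0 (cast_ord (esym (mul1n 16)) j)) ^+ 2).

Definition C1curve (c : R -> 'M[R]_4) : Prop :=
  forall i j, (forall t, derivable (fun s => c s i j) t 1) /\
              continuous (derive1 (fun s => c s i j)).
Definition dcurve (c : R -> 'M[R]_4) (t : R) : 'M[R]_4 :=
  \matrix_(i, j) (derive1 (fun s => c s i j) t).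

Definition curve_len (A : 'M[R]_16) (c : R -> 'M[R]_4) : \bar R :=
  (\int[lebesgue_measure]_(t in `[0%R, 1%R]) (lnorm A (invmx (c t) *m dcurve c t))%:E)%E.

Definition gdist (A : 'M[R]_16) (g h : 'M[R]_4) : \bar R :=
  ereal_inf [set curve_len A c | c in
     [set c | C1curve c /\ c 0 = g /\ c 1 = h /\ forall t, 0 <= t <= 1 -> isomG (c t)]].

Definition bounded_distortion (A : 'M[R]_16) (X : set 'M[R]_4) (e : 'M[R]_4 -> 'M[R]_4)
    (eps D : R) : Prop :=
  forall u v, X u -> X v -> (gdist A 1 (arr u v) < D%:E)%E ->
    (gdist A (arr u v) (arr (e u) (e v)) < eps%:E)%E.

End Hyperbolic.

(* Main.v *)
Require Import Defs.
From HB Require Import structures.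
From mathcomp Require Import all_boot all_order all_algebra.
From mathcomp Require Import all_classical all_reals all_analysis.
From mathcomp Require Import ring lra.
Import Order.TTheory GRing.Theory Num.Theory.
Import numFieldNormedType.Exports.
Set Implicit Arguments.
Unset Strict Implicit.
Unset Printing Implicit Defensive.
Local Open Scope classical_set_scope.
Local Open Scope ring_scope.

(* The frames of two sequences are compared through one-parameter groups: along [gam i] the
   frames move by [boost i1], across from [gam i] to [gam i.+1] by [boost i2], and in the
   semi-linear sequence by the same moves with slightly changed lengths and extra rotations
   about the same axes. Conjugating every crossing back to the position [s] of the frame [u]
   on [gam 0] turns [u^-1 v] into a product of factors [Ad (P (i - s)) (Q (u_i))], where [P],
   [Q] are the boosts along and across, followed by a translation [P y].

   In light-cone coordinates these factors are positive matrices, so an upper bound on the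
   displacement of [u^-1 v] bounds [y] and the sum of the [u_i * 2 cosh (i - s)]; since
   [u_i > exp (- R / 2) / B], the number of crossings is at most [R + O(1)]. A bound on the
   displacement follows from [d(1, g) < D], because the logarithmic derivative of the lower
   right entry along a curve in [G] is controlled by the speed of the curve.

   Interpolating all complex distances linearly gives a curve in [G] from [u^-1 v] to
   [e(u)^-1 e(v)]. The derivative of a crossing factor is [O(eps * u_i * cosh (i - s))], that
   of a sliding factor is [O(eps / R)], and all partial products are bounded, so the length of
   the curve is [O(eps)]. *)

Local Notation rot := Defs.rot.

(** * Entrywise computation with matrices of size 4 *)

(** The indices [i0], ..., [i3] are [inord] terms, which plain case analysis on an ordinal does not
    produce. *)
Lemma ord4_ind (P : 'I_4 -> Prop) :
  P i0 -> P i1 -> P i2 -> P i3 -> forall i, P i.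
Proof.
move=> p0 p1 p2 p3 [m hm].
have E (k : 'I_4) : val k = m -> P k -> P (Ordinal hm).
  by move=> km; rewrite (_ : k = Ordinal hm) //; apply: val_inj.
case: m hm E => [|[|[|[|m]]]] hm E //.
- by apply: (E i0) p0; rewrite /= inordK.
- by apply: (E i1) p1; rewrite /= inordK.
- by apply: (E i2) p2; rewrite /= inordK.
- by apply: (E i3) p3; rewrite /= inordK.
Qed.

Lemma sum4 (V : nmodType) (F : 'I_4 -> V) :
  \sum_i F i = F i0 + F i1 + F i2 + F i3.
Proof.
rewrite !big_ord_recl big_ord0 addr0 !addrA.
by congr (F _ + F _ + F _ + F _); apply: val_inj; rewrite /= inordK.
Qed.

Lemma ord4_eqE :
  ((i0 == i1 = false) * (i0 == i2 = false) * (i0 == i3 = false)) *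
  ((i1 == i0 = false) * (i1 == i2 = false) * (i1 == i3 = false)) *
  ((i2 == i0 = false) * (i2 == i1 = false) * (i2 == i3 = false)) *
  ((i3 == i0 = false) * (i3 == i1 = false) * (i3 == i2 = false)).
Proof.
by do !split; apply/eqP => /(congr1 val) /=; rewrite !inordK.
Qed.

Lemma mulmx4 (V : pzSemiRingType) m n (X : 'M[V]_(m, 4)) (Y : 'M[V]_(4, n)) i j :
  (X *m Y) i j =
  X i i0 * Y i0 j + X i i1 * Y i1 j + X i i2 * Y i2 j + X i i3 * Y i3 j.
Proof. by rewrite mxE sum4. Qed.

(* [cosh], [cos], ... must be generalized before this tactic: otherwise unification
   unfolds them down to limits of series. *)
Ltac mx4_entries :=
  apply/matrixP; refine (@ord4_ind _ _ _ _ _); refine (@ord4_ind _ _ _ _ _);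
  rewrite ?(mulmx4, mxE) ?(ord4_eqE, eqxx) /=
    ?(mul0r, mulr0, mul1r, mulr1, add0r, addr0, oppr0, subr0) //.

(** * Hyperbolic functions, boosts, rotations and the isometry group *)

Section Isometries.
Context {R : realType}.
Implicit Types (F H X Y : 'M[R]_4) (s t x y : R).

Lemma cosh_sub_sinh t : cosh t ^+ 2 - sinh t ^+ 2 = 1.
Proof.
rewrite /cosh /sinh; have := expRxMexpNx_1 t.
by move: (expR t) (expR (- t)) => a b ab; field: ab.
Qed.

Lemma coshD s t : cosh (s + t) = cosh s * cosh t + sinh s * sinh t.
Proof. by rewrite /cosh /sinh opprD !expRD; field. Qed.

Lemma sinhD s t : sinh (s + t) = sinh s * cosh t + cosh s * sinh t.
Proof. by rewrite /cosh /sinh opprD !expRD; field. Qed.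

Lemma coshN t : cosh (- t) = cosh t.
Proof. by rewrite /cosh opprK addrC. Qed.

Lemma sinhN t : sinh (- t) = - sinh t.
Proof. by rewrite /sinh opprK; field. Qed.

Lemma cosh0 : cosh (0 : R) = 1.
Proof. by rewrite /cosh oppr0 expR0; field. Qed.

Lemma sinh0 : sinh (0 : R) = 0.
Proof. by rewrite /sinh oppr0 expR0; field. Qed.

Lemma cosh_gt0 t : 0 < cosh t.
Proof. by rewrite /cosh; have := expR_gt0 t; have := expR_gt0 (- t); lra. Qed.

Lemma boost1D s t : boost i1 (s + t) = boost i1 s *m boost i1 t.
Proof.
rewrite /boost coshD sinhD.
by move: (cosh s) (cosh t) (sinh s) (sinh t) => ? ? ? ?; mx4_entries; ring.
Qed.

Lemma boost2D s t : boost i2 (s + t) = boost i2 s *m boost i2 t.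
Proof.
rewrite /boost coshD sinhD.
by move: (cosh s) (cosh t) (sinh s) (sinh t) => ? ? ? ?; mx4_entries; ring.
Qed.

Lemma rot01D s t : rot i0 i1 (s + t) = rot i0 i1 s *m rot i0 i1 t.
Proof.
rewrite /Defs.rot cosD sinD.
by move: (cos s) (cos t) (sin s) (sin t) => ? ? ? ?; mx4_entries; ring.
Qed.

Lemma rot02D s t : rot i0 i2 (s + t) = rot i0 i2 s *m rot i0 i2 t.
Proof.
rewrite /Defs.rot cosD sinD.
by move: (cos s) (cos t) (sin s) (sin t) => ? ? ? ?; mx4_entries; ring.
Qed.

Lemma boost10 : boost i1 (0 : R) = 1%:M.
Proof. by rewrite /boost cosh0 sinh0; mx4_entries. Qed.

Lemma rot010 : rot i0 i1 (0 : R) = 1%:M.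
Proof. by rewrite /Defs.rot cos0 sin0; mx4_entries. Qed.

Lemma rot020 : rot i0 i2 (0 : R) = 1%:M.
Proof. by rewrite /Defs.rot cos0 sin0; mx4_entries. Qed.

Lemma boost1_rot02 s t : boost i1 s *m rot i0 i2 t = rot i0 i2 t *m boost i1 s.
Proof.
rewrite /boost /Defs.rot.
by move: (cosh s) (sinh s) (cos t) (sin t) => ? ? ? ?; mx4_entries; ring.
Qed.

(** On [isomG] this is the inverse. Being linear in the entries, it is differentiable along any
    curve of matrices, and it only permutes entries up to sign. *)
Definition jinv F : 'M[R]_4 := Jmx R *m F^T *m Jmx R.

Lemma trJ : (Jmx R)^T = Jmx R.
Proof. by mx4_entries. Qed.


Lemma mulJmx n (X : 'M[R]_(4, n)) i j :
  (Jmx R *m X) i j = (if i == i3 then -1 else 1) * X i j.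
Proof.
rewrite mxE (bigD1 i) //= big1 ?addr0 ?mxE ?eqxx // => k ki.
by rewrite mxE eq_sym (negbTE ki) mul0r.
Qed.

Lemma mulmxJ n (X : 'M[R]_(n, 4)) i j :
  (X *m Jmx R) i j = X i j * (if j == i3 then -1 else 1).
Proof. by rewrite -[X]trmxK -[Jmx R]trJ -trmx_mul mxE mulJmx !mxE mulrC. Qed.

Lemma mulJJ : Jmx R *m Jmx R = 1%:M.
Proof.
apply/matrixP => i j; rewrite mulJmx !mxE.
by case: (i == j); rewrite ?mulr0 //; case: ifP; rewrite ?mulrNN mulr1.
Qed.

Lemma mul_jinv F : isomG F -> jinv F *m F = 1%:M.
Proof. by case=> h _; rewrite /jinv -!mulmxA mulmxA in h *; rewrite h mulJJ. Qed.

Lemma isomG_unit F : isomG F -> F \in unitmx.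
Proof. by case=> _ [d _]; rewrite unitmxE d unitr1. Qed.

Lemma invmx_isomG F : isomG F -> invmx F = jinv F.
Proof.
by move=> hF; rewrite -[LHS]mul1mx -(mul_jinv hF) mulmxK // isomG_unit.
Qed.

Lemma mul_isomG_jinv F : isomG F -> F *m jinv F = 1%:M.
Proof. by move=> hF; rewrite -invmx_isomG // mulmxV // isomG_unit. Qed.

Lemma isomG_row F : isomG F -> F *m Jmx R *m F^T = Jmx R.
Proof.
move=> hF; have := mul_isomG_jinv hF; rewrite /jinv !mulmxA => e.
by rewrite -[LHS]mulmx1 -mulJJ mulmxA e mul1mx.
Qed.

Lemma isomG_row3 F : isomG F ->
  F i3 i3 ^+ 2 = 1 + F i3 i0 ^+ 2 + F i3 i1 ^+ 2 + F i3 i2 ^+ 2.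
Proof.
move/isomG_row/matrixP/(_ i3 i3); rewrite ?(mxE, sum4) ?(ord4_eqE, eqxx) /=.
move: (F i3 i0) (F i3 i1) (F i3 i2) (F i3 i3) => a b c d h; lra.
Qed.

Lemma isomG_col3 F : isomG F ->
  F i3 i3 ^+ 2 = 1 + F i0 i3 ^+ 2 + F i1 i3 ^+ 2 + F i2 i3 ^+ 2.
Proof.
case=> /matrixP/(_ i3 i3) + _; rewrite ?(mxE, sum4) ?(ord4_eqE, eqxx) /=.
move: (F i0 i3) (F i1 i3) (F i2 i3) (F i3 i3) => a b c d h; lra.
Qed.

Lemma normr_le_sqr (x y : R) : 0 <= y -> x ^+ 2 <= y ^+ 2 -> `|x| <= y.
Proof. by move=> y0 h; rewrite -ler_sqr ?nnegrE // real_normK // num_real. Qed.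


Lemma isomG_row3_le F k : isomG F -> `|F i3 k| <= F i3 i3.
Proof.
move=> hF; have [_ [_ p]] := hF; have h := isomG_row3 hF.
have [[a b] c] := (sqr_ge0 (F i3 i0), sqr_ge0 (F i3 i1), sqr_ge0 (F i3 i2)).
by move: k; refine (@ord4_ind _ _ _ _ _); apply: normr_le_sqr; rewrite ?(ltW p) // h; lra.
Qed.

Lemma isomG_col3_le F k : isomG F -> `|F k i3| <= F i3 i3.
Proof.
move=> hF; have [_ [_ p]] := hF; have h := isomG_col3 hF.
have [[a b] c] := (sqr_ge0 (F i0 i3), sqr_ge0 (F i1 i3), sqr_ge0 (F i2 i3)).
by move: k; refine (@ord4_ind _ _ _ _ _); apply: normr_le_sqr; rewrite ?(ltW p) // h; lra.
Qed.

(** The delicate clause is the sign of the lower right entry. Row 3 of [F] and column 3 of [H] are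
    unit timelike vectors; Lagrange's identity writes [(p * q) ^+ 2] minus the squared product of
    the spatial parts as a sum of squares plus 1, so the time parts dominate. *)
Lemma isomG_mul F H : isomG F -> isomG H -> isomG (F *m H).
Proof.
move=> hF hH; have [jF [dF pF]] := hF; have [jH [dH pH]] := hH.
split; first by rewrite trmx_mul -!mulmxA (mulmxA F^T) (mulmxA (F^T *m _)) jF mulmxA.
split; first by rewrite det_mulmx dF dH mulr1.
have rF := isomG_row3 hF; have cH := isomG_col3 hH.
rewrite mxE sum4.
move: (F i3 i0) (F i3 i1) (F i3 i2) (F i3 i3) rF pF => a b c p rF pF.
move: (H i0 i3) (H i1 i3) (H i2 i3) (H i3 i3) cH pH => x y z q cH pH.
have pq : 0 < p * q by exact: mulr_gt0.
have cs : (a * x + b * y + c * z) ^+ 2 < (p * q) ^+ 2.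
  have -> : (p * q) ^+ 2 = (a * x + b * y + c * z) ^+ 2 + ((a * y - b * x) ^+ 2
    + (a * z - c * x) ^+ 2 + (b * z - c * y) ^+ 2 + a ^+ 2 + b ^+ 2 + c ^+ 2 +
    x ^+ 2 + y ^+ 2 + z ^+ 2 + 1) by rewrite exprMn rF cH; ring.
  rewrite ltrDl; apply: ltr_wpDl => //.
  by rewrite !addr_ge0 ?sqr_ge0.
have /ltr_normlW h : `|- (a * x + b * y + c * z)| < p * q.
  rewrite normrN -ltr_sqr ?nnegrE ?normr_ge0 ?(ltW pq) //.
  by rewrite real_normK // num_real.
lra.
Qed.

Lemma jinv33 F : jinv F i3 i3 = F i3 i3.
Proof. by rewrite mulmxJ mulJmx mxE eqxx mulrN1 mulN1r opprK. Qed.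

Lemma isomG_jinv F : isomG F -> isomG (jinv F).
Proof.
move=> hF; have [_ [dF pF]] := hF.
split; last split.
- rewrite /jinv !trmx_mul trJ trmxK -!mulmxA (mulmxA (Jmx R) (Jmx R)) mulJJ mul1mx.
  by rewrite (mulmxA F) (mulmxA (F *m _)) isomG_row // mulJJ mulmx1.
- rewrite /jinv !det_mulmx det_tr dF mulr1 -det_mulmx mulJJ; exact: det1.
- by rewrite jinv33.
Qed.

Lemma isomG_invmx F : isomG F -> isomG (invmx F).
Proof. by move=> hF; rewrite invmx_isomG //; exact: isomG_jinv. Qed.

Ltac mx4_isometry :=
  apply/matrixP; refine (@ord4_ind _ _ _ _ _); refine (@ord4_ind _ _ _ _ _);
  rewrite mulmx4 !mulJmx !mxE ?(ord4_eqE, eqxx) /=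
    ?(mul0r, mulr0, mul1r, mulr1, add0r, addr0, oppr0, subr0) //.

(* The determinant of a one-parameter subgroup of O(3,1) is a square. *)
Lemma oneparam_isomG (G : R -> 'M[R]_4) t :
  (forall s t, G (s + t) = G s *m G t) ->
  (forall t, (G t)^T *m Jmx R *m G t = Jmx R) -> 0 < G t i3 i3 -> isomG (G t).
Proof.
move=> GD GJ G33; split=> //; split=> //.
have d2 : \det (G t) ^+ 2 = 1.
  have := congr1 (@determinant _ _) (GJ t); rewrite !det_mulmx det_tr.
  have : \det (Jmx R) ^+ 2 = 1 by rewrite expr2 -det_mulmx mulJJ det1.
  move: (\det (G t)) (\det (Jmx R)) => g j j2 h.
  by rewrite -[LHS]mulr1 -j2; ring: h j2.
have d0 : 0 <= \det (G t).
  by rewrite (_ : t = t / 2 + t / 2) ?GD ?det_mulmx -?expr2 ?sqr_ge0 //; field.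
by apply/eqP; rewrite -(@pexpr_eq1 _ _ 2) // d2.
Qed.

Lemma isomG_boost1 t : isomG (boost i1 t).
Proof.
apply: oneparam_isomG; first exact: boost1D; last by rewrite !mxE !eqxx orbT cosh_gt0.
move=> x; have := cosh_sub_sinh x; rewrite -mulmxA /boost.
move: (cosh x) (sinh x) => a b ab; mx4_isometry; lra.
Qed.

Lemma isomG_boost2 t : isomG (boost i2 t).
Proof.
apply: oneparam_isomG; first exact: boost2D; last by rewrite !mxE !eqxx orbT cosh_gt0.
move=> x; have := cosh_sub_sinh x; rewrite -mulmxA /boost.
move: (cosh x) (sinh x) => a b ab; mx4_isometry; lra.
Qed.

Lemma isomG_rot01 t : isomG (rot i0 i1 t).
Proof.
apply: oneparam_isomG; first exact: rot01D; last by rewrite !mxE !ord4_eqE eqxx.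
move=> x; have := cos2Dsin2 x; rewrite -mulmxA /Defs.rot.
move: (cos x) (sin x) => a b ab; mx4_isometry; lra.
Qed.

Lemma isomG_rot02 t : isomG (rot i0 i2 t).
Proof.
apply: oneparam_isomG; first exact: rot02D; last by rewrite !mxE !ord4_eqE eqxx.
move=> x; have := cos2Dsin2 x; rewrite -mulmxA /Defs.rot.
move: (cos x) (sin x) => a b ab; mx4_isometry; lra.
Qed.

Lemma boost1N s : boost i1 s *m boost i1 (- s) = 1%:M.
Proof. by rewrite -boost1D subrr boost10. Qed.

Lemma boost1Nl s : boost i1 (- s) *m boost i1 s = 1%:M.
Proof. by rewrite -boost1D addNr boost10. Qed.

End Isometries.

(** * Norms and curves *)

Section EntryNorm.
Context {R : realType}.
Implicit Types X Y : 'M[R]_4.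

(** The entrywise l^1 norm: submultiplicative, and invariant under [jinv]. *)
Definition nm X : R := \sum_i \sum_j `|X i j|.

Lemma nm_ge0 X : 0 <= nm X.
Proof. by apply: sumr_ge0 => i _; apply: sumr_ge0 => j _; exact: normr_ge0. Qed.

Lemma nm_entry X i j : `|X i j| <= nm X.
Proof.
rewrite /nm (bigD1 i) //= (bigD1 j) //= -addrA lerDl addr_ge0 //.
  exact: sumr_ge0.
by apply: sumr_ge0 => k _; exact: sumr_ge0.
Qed.

Lemma nmD X Y : nm (X + Y) <= nm X + nm Y.
Proof.
rewrite /nm -big_split; apply: ler_sum => i _; rewrite -big_split.
by apply: ler_sum => j _; rewrite mxE ler_normD.
Qed.

Lemma nmZ a X : nm (a *: X) = `|a| * nm X.
Proof.
rewrite /nm mulr_sumr; apply: eq_bigr => i _; rewrite mulr_sumr.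
by apply: eq_bigr => j _; rewrite mxE normrM.
Qed.

Lemma nmM X Y : nm (X *m Y) <= nm X * nm Y.
Proof.
have row_le k : \sum_j `|Y k j| <= nm Y.
  rewrite /nm [leRHS](bigD1 k) //= lerDl.
  by apply: sumr_ge0 => i _; exact: sumr_ge0.
rewrite {1 2}/nm mulr_suml; apply: ler_sum => i _.
apply: (@le_trans _ _ (\sum_k `|X i k| * \sum_j `|Y k j|)).
  under [leRHS]eq_bigr do rewrite mulr_sumr.
  rewrite exchange_big /=; apply: ler_sum => j _; rewrite mxE.
  by apply: (le_trans (ler_norm_sum _ _ _)); apply: ler_sum => k _; rewrite normrM.
by rewrite mulr_suml; apply: ler_sum => k _; rewrite ler_wpM2l.
Qed.

Lemma nm_le X (b : R) : (forall i j, `|X i j| <= b) -> nm X <= 16 * b.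
Proof.
move=> h; apply: (@le_trans _ _ (\sum_(i < 4) \sum_(j < 4) b)).
  by apply: ler_sum => i _; apply: ler_sum => j _.
by rewrite !sumr_const card_ord -mulrnA mulr_natl.
Qed.

Lemma nm_jinv X : nm (jinv X) = nm X.
Proof.
have e i j : `|jinv X i j| = `|X j i|.
  rewrite mulmxJ mulJmx mxE !normrM.
  by do 2!(case: ifP => _); rewrite ?normrN1 ?normr1 ?mul1r ?mulr1.
rewrite /nm exchange_big /=; apply: eq_bigr => i _; apply: eq_bigr => j _; exact: e.
Qed.

End EntryNorm.

(** * Differentiable curves in the isometry group *)

Section Curves.
Context {R : realType}.
Implicit Types (c f : R -> 'M[R]_4) (a b N : R).

(** [C1curve] with the derivative named, so that derivatives of products come as explicit formulas
    that can be estimated. *)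
Definition path_deriv c c' := forall i j,
  (forall t : R, is_derive t (1 : R) (fun s => c s i j : R) (c' t i j)) /\
  continuous (fun t => c' t i j).

Lemma path_derivP c : C1curve c <-> path_deriv c (dcurve c).
Proof.
split=> h i j; have [h1 h2] := h i j; split.
- by move=> t; rewrite mxE derive1E; apply: DeriveDef.
- by move=> t; under eq_fun do rewrite mxE; exact: h2.
- by move=> t; have [] := h1 t.
- by move=> t; move: (h2 t); under eq_fun do rewrite mxE.
Qed.

Lemma path_deriv_dcurve c c' t : path_deriv c c' -> dcurve c t = c' t.
Proof.
move=> h; apply/matrixP => i j; rewrite mxE derive1E.
by have [h1 _] := h i j; rewrite (@derive_val _ _ _ _ _ _ _ (h1 t)).
Qed.

Lemma path_deriv_C1 c c' : path_deriv c c' -> C1curve c.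
Proof.
move=> h; apply/path_derivP => i j; have [h1 h2] := h i j.
rewrite (_ : dcurve c = c') //; apply/funext => t; exact: path_deriv_dcurve.
Qed.

Lemma path_deriv_cont c c' i j : path_deriv c c' -> continuous (fun t => c t i j).
Proof.
move=> h t; apply: differentiable_continuous; apply/derivable1_diffP.
by have [h1 _] := h i j; have [] := h1 t.
Qed.

Lemma path_deriv_cst X : path_deriv (fun=> X) (fun=> 0).
Proof.
move=> i j; split=> [t|t]; last by under eq_fun do rewrite mxE; exact: cst_continuous.
by rewrite mxE; exact: is_derive_cst.
Qed.

Lemma path_derivM c c' f f' : path_deriv c c' -> path_deriv f f' ->
  path_deriv (fun t => c t *m f t) (fun t => c' t *m f t + c t *m f' t).
Proof.
move=> hc hf i j.
have cM k (t : R) : is_derive t (1 : R) (fun s => c s i k * f s k j : R)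
    (c' t i k * f t k j + c t i k * f' t k j).
  have [[h1 _] [h2 _]] := (hc i k, hf k j).
  have := is_deriveM (h1 t) (h2 t); rewrite /GRing.scale /= => h.
  by rewrite addrC (mulrC (c' t i k)).
split=> [t|].
  under eq_fun do rewrite mulmx4.
  rewrite mxE !mulmx4; set d := (X in is_derive _ _ _ X).
  rewrite (_ : d =
    (c' t i i0 * f t i0 j + c t i i0 * f' t i0 j) +
    (c' t i i1 * f t i1 j + c t i i1 * f' t i1 j) +
    (c' t i i2 * f t i2 j + c t i i2 * f' t i2 j) +
    (c' t i i3 * f t i3 j + c t i i3 * f' t i3 j)); last by rewrite /d; ring.
  exact: is_deriveD (is_deriveD (is_deriveD (cM _ _) (cM _ _)) (cM _ _)) (cM _ _).
have cMl k : continuous (fun t => c' t i k * f t k j).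
  move=> t; have [_ h] := hc i k.
  by apply: cvgM; [exact: h | exact: path_deriv_cont hf _].
have cMr k : continuous (fun t => c t i k * f' t k j).
  move=> t; have [_ h] := hf k j.
  by apply: cvgM; [exact: path_deriv_cont hc _ | exact: h].
under eq_fun do rewrite mxE !mulmx4.
move=> t; apply: cvgD.
  exact: cvgD (cvgD (cvgD (cMl _ _) (cMl _ _)) (cMl _ _)) (cMl _ _).
exact: cvgD (cvgD (cvgD (cMr _ _) (cMr _ _)) (cMr _ _)) (cMr _ _).
Qed.

Lemma path_deriv_tr c c' : path_deriv c c' ->
  path_deriv (fun t => (c t)^T) (fun t => (c' t)^T).
Proof.
move=> h i j; have [h1 h2] := h j i; split=> [t|].
  by rewrite mxE; under eq_fun do rewrite mxE.
by under eq_fun do rewrite mxE.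
Qed.

Lemma path_deriv_ext c c1 d d1 : c =1 c1 -> d =1 d1 -> path_deriv c d -> path_deriv c1 d1.
Proof. by move=> /funext -> /funext ->. Qed.

Lemma path_deriv_jinv c c' : path_deriv c c' ->
  path_deriv (fun t => jinv (c t)) (fun t => jinv (c' t)).
Proof.
move=> /path_deriv_tr h.
have := path_derivM (path_derivM (path_deriv_cst (Jmx R)) h) (path_deriv_cst (Jmx R)).
by apply: path_deriv_ext => t //; rewrite mul0mx add0r mulmx0 addr0.
Qed.

Definition unit_itv (t : R) := 0 <= t <= 1.

(* The shape of the bounds makes [a] and [b] additive under multiplication by a factor
   close to the identity, see [tameM]. *)
Definition tame c (N a b : R) := exists c', path_deriv c c' /\
  forall t, unit_itv t ->
    [/\ isomG (c t), nm (c t) <= N * expR a & nm (c' t) <= N * expR a * b].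

Definition tame_step f (a b : R) := exists f', path_deriv f f' /\
  forall t, unit_itv t -> [/\ isomG (f t), nm (f t - 1%:M) <= a & nm (f' t) <= b].

(** Since [nm (X *m f t) <= nm X * (1 + a')] and [1 + a' <= expR a'], the cost of a factor is added
    in the exponent; the Leibniz rule adds the speeds. Long products are thus controlled by sums
    over their factors, with [N] unchanged. *)
Lemma tameM c f N a b a' b' : 0 <= N -> 0 <= b -> 0 <= a' -> 0 <= b' ->
  tame c N a b -> tame_step f a' b' -> tame (fun t => c t *m f t) N (a + a') (b + b').
Proof.
move=> N0 b0 a0 b'0 [c' [dc hc]] [f' [df hf]].
exists (fun t => c' t *m f t + c t *m f' t); split; first exact: path_derivM.
move=> t ht; have [ic nc nc'] := hc t ht; have [jf nf nf'] := hf t ht.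
have nM X : nm (X *m f t) <= nm X * expR a'.
  rewrite -{1}(subrK 1%:M (f t)) mulmxDr mulmx1.
  apply: (le_trans (nmD _ _)); apply: (@le_trans _ _ (nm X * a' + nm X)).
    by rewrite lerD2r; apply: le_trans (nmM _ _) _; rewrite ler_wpM2l ?nm_ge0.
  by rewrite -{2}[nm X]mulr1 -mulrDr ler_wpM2l ?nm_ge0 // addrC expR_ge1Dx.
have e0 := expR_gt0 a'; have e0' := expR_gt0 a.
rewrite expRD mulrA; split; first exact: isomG_mul.
  by apply: (le_trans (nM _)); rewrite ler_wpM2r // ltW.
apply: (le_trans (nmD _ _)); rewrite mulrDr; apply: lerD.
  apply: (le_trans (nM _)); rewrite mulrAC ler_wpM2r // ltW //.
apply: (le_trans (nmM _ _)); apply: ler_pM; rewrite ?nm_ge0 //.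
apply: (le_trans nc); rewrite -{1}[N * _]mulr1 ler_wpM2l //.
  by rewrite mulr_ge0 // ltW.
by apply: le_trans (expR_ge1Dx _); rewrite lerDl.
Qed.

Lemma tame_mulr_cst c H N a b : isomG H -> 0 <= N -> 0 <= b ->
  tame c N a b -> tame (fun t => c t *m H) (N * nm H) a b.
Proof.
move=> iH N0 b0 [c' [dc hc]]; exists (fun t => c' t *m H); split.
  by apply: path_deriv_ext (path_derivM dc (path_deriv_cst H)) => t //; rewrite mulmx0 addr0.
move=> t ht; have [ic nc nc'] := hc t ht; split; first exact: isomG_mul.
  by apply: (le_trans (nmM _ _)); rewrite mulrAC ler_wpM2r ?nm_ge0.
apply: (le_trans (nmM _ _)).
by rewrite -(mulrA N) (mulrC (nm H)) mulrA (mulrAC _ (nm H)) ler_wpM2r ?nm_ge0.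
Qed.

(** Serves the pairs whose first frame lies on the last geodesic: their arrows are inverses of
    arrows already treated. *)
Lemma tame_jinv c N a b : tame c N a b -> tame (fun t => jinv (c t)) N a b.
Proof.
move=> [c' [dc hc]]; exists (fun t => jinv (c' t)); split; first exact: path_deriv_jinv.
move=> t ht; have [ic nc nc'] := hc t ht; rewrite !nm_jinv; split=> //.
exact: isomG_jinv.
Qed.

Lemma tame_cst X N : isomG X -> nm X <= N -> tame (fun=> X) N 0 0.
Proof.
move=> iX nX; exists (fun=> 0); split; first exact: path_deriv_cst.
move=> t _; rewrite expR0 mulr1 mulr0; split=> //.
by rewrite -(scale0r 0) nmZ normr0 mul0r.
Qed.

End Curves.

(** * One-parameter groups and their conjugates *)

Section OneParameter.
Context {R : realType}.
Implicit Types (s t x a b : R) (X Z : 'M[R]_4).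

Lemma is_derive_sinh x : is_derive x 1 (@sinh R) (cosh x).
Proof.
rewrite /sinh /cosh.
have h : is_derive x 1 (expR \o -%R : R -> R) (expR (- x) * -1).
  by apply: is_derive1_comp; rewrite -?[-1]mulr1.
have := is_deriveZ (2^-1) (is_deriveB (is_derive_expR x) h).
rewrite /GRing.scale /= => g.
have -> : (fun t => (expR t - expR (- t)) / 2) = (2^-1 \*: (expR - (expR \o -%R)) : R -> R).
  by apply/funext => t; rewrite mulrC.
by rewrite mulrC; apply: is_derive_eq; rewrite mulrN1 opprK.
Qed.

Lemma is_derive_cosh x : is_derive x 1 (@cosh R) (sinh x).
Proof.
rewrite /sinh /cosh.
have h : is_derive x 1 (expR \o -%R : R -> R) (expR (- x) * -1).
  by apply: is_derive1_comp; rewrite -?[-1]mulr1.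
have := is_deriveZ (2^-1) (is_deriveD (is_derive_expR x) h).
rewrite /GRing.scale /= => g.
have -> : (fun t => (expR t + expR (- t)) / 2) = (2^-1 \*: (expR + (expR \o -%R)) : R -> R).
  by apply/funext => t; rewrite mulrC.
by rewrite mulrC; apply: is_derive_eq; rewrite mulrN1.
Qed.

Lemma cosh_le_expR t : cosh t <= expR `|t|.
Proof.
have h : expR t <= expR `|t| by rewrite ler_expR ler_norm.
have h' : expR (- t) <= expR `|t| by rewrite ler_expR -normrN ler_norm.
by rewrite /cosh; lra.
Qed.

(** Oddness reduces to [0 <= t], where the mean value theorem applies. It is used for [sinh] and
    [sin]. *)
Lemma normr_le_of_derive (S S' : R -> R) : S 0 = 0 -> (forall t, S (- t) = - S t) ->
  (forall t, is_derive t 1 S (S' t)) -> (forall t, `|S' t| <= expR `|t|) ->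
  forall t, `|S t| <= `|t| * expR `|t|.
Proof.
move=> S0 SN dS bS.
suff pos t : 0 <= t -> `|S t| <= `|t| * expR `|t|.
  move=> t; case: (leP 0 t) => [/pos //|/ltW t0].
  by have := pos (- t); rewrite SN !normrN oppr_ge0; apply.
move=> t0; have cS : {within `[0, t], continuous S}.
  by apply: derivable_within_continuous => x _; have [] := dS x.
have [c] := MVT_segment t0 (fun x _ => dS x) cS.
rewrite in_itv /= => /andP[c0 ct]; rewrite S0 !subr0 => ->.
rewrite normrM mulrC ler_wpM2l // (le_trans (bS c)) // ler_expR !ger0_norm //.
Qed.

Lemma normr_sinh_le t : `|sinh t| <= `|t| * expR `|t|.
Proof.
apply: (normr_le_of_derive sinh0 sinhN is_derive_sinh) => {}t.
by rewrite gtr0_norm ?cosh_gt0 // cosh_le_expR.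
Qed.

Lemma normr_sin_le t : `|sin t| <= `|t| * expR `|t|.
Proof.
refine (@normr_le_of_derive sin cos (@sin0 R) (@sinN R) (@is_derive_sin R) _ t) => {}t.
have h : 1 <= expR `|t| by have := expR_ge1Dx `|t|; have := normr_ge0 t; lra.
by apply: le_trans h; rewrite ler_norml cos_geN1 cos_le1.
Qed.

(** Half-angle step: for [u] equal to [sinh (t / 2)] or [sin (t / 2)], the number [2 * u ^+ 2] is
    [cosh t - 1] or [1 - cos t], so second-order bounds follow from first-order ones. *)
Lemma half_square_le (u t : R) : `|u| <= `|t / 2| * expR `|t / 2| ->
  `|2 * u ^+ 2| <= t ^+ 2 * expR `|t|.
Proof.
move=> h; rewrite normrM normrX (ger0_norm (ler0n _ _)).
have e : t ^+ 2 * expR `|t| = 4 * (`|t / 2| * expR `|t / 2|) ^+ 2.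
  have -> : expR `|t| = expR `|t / 2| ^+ 2.
    by rewrite expr2 -expRD normrM (@ger0_norm _ 2^-1) ?invr_ge0 //; congr expR; field.
  by rewrite exprMn -(normrX 2 (t / 2)) (@ger0_norm _ ((t / 2) ^+ 2)) ?sqr_ge0 //; field.
have h2 : `|u| ^+ 2 <= (`|t / 2| * expR `|t / 2|) ^+ 2.
  by rewrite ler_sqr ?nnegrE // (le_trans _ h).
have h3 := sqr_ge0 (`|t / 2| * expR `|t / 2|).
rewrite e; lra.
Qed.

Lemma normr_cosh1_le t : `|cosh t - 1| <= t ^+ 2 * expR `|t|.
Proof.
have -> : cosh t - 1 = 2 * sinh (t / 2) ^+ 2.
  rewrite {1}(_ : t = t / 2 + t / 2); last by field.
  rewrite coshD; have := cosh_sub_sinh (t / 2).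
  move: (cosh _) (sinh _) => p q h; lra.
exact/half_square_le/normr_sinh_le.
Qed.

Lemma normr_1cos_le t : `|1 - cos t| <= t ^+ 2 * expR `|t|.
Proof.
have -> : 1 - cos t = 2 * sin (t / 2) ^+ 2.
  rewrite {1}(_ : t = t / 2 + t / 2); last by field.
  rewrite cosD; have := cos2Dsin2 (t / 2).
  move: (cos _) (sin _) => p q h; lra.
exact/half_square_le/normr_sin_le.
Qed.

(* The Rodrigues form of a one-parameter group with generator [Z], [Z^3 = +-Z]. *)
Definition oneparam (G : R -> 'M[R]_4) Z := exists S T S' : R -> R,
  (forall t, G t = 1%:M + S t *: Z + T t *: (Z *m Z)) /\
  ((forall t, `|S t| <= `|t| * expR `|t|) /\
   (forall t, `|T t| <= t ^+ 2 * expR `|t|) /\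
   (forall t, `|S' t| <= expR `|t|)) /\
  ((forall t, is_derive t 1 S (S' t)) /\ (forall t, is_derive t 1 T (S t)) /\
   continuous S').

(** For spatial indices, [Kgen k] and [Lgen k l] are the elements of so(3,1) that generate [boost k]
    and [rot k l]. *)
Definition Kgen (k : 'I_4) : 'M[R]_4 := delta_mx k i3 + delta_mx i3 k.
Definition Lgen (k l : 'I_4) : 'M[R]_4 := delta_mx l k - delta_mx k l.

Lemma derive_continuous (S S' : R -> R) :
  (forall t, is_derive t 1 S (S' t)) -> continuous S.
Proof.
move=> h t; apply: differentiable_continuous; apply/derivable1_diffP.
by have [] := h t.
Qed.

Lemma oneparam_hyperbolic G Z :
  (forall t, G t = 1%:M + sinh t *: Z + (cosh t - 1) *: (Z *m Z)) -> oneparam G Z.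
Proof.
move=> GE; exists (@sinh R), (fun t => cosh t - 1), (@cosh R); split=> //.
split; first split; [exact: normr_sinh_le | split | split; [|split]].
- exact: normr_cosh1_le.
- by move=> t; rewrite gtr0_norm ?cosh_gt0 // cosh_le_expR.
- exact: is_derive_sinh.
- move=> t; rewrite -[sinh t]subr0.
  exact: is_deriveB (is_derive_cosh t) (is_derive_cst _ _ _).
- exact: derive_continuous is_derive_cosh.
Qed.

Lemma oneparam_elliptic G Z :
  (forall t, G t = 1%:M + sin t *: Z + (1 - cos t) *: (Z *m Z)) -> oneparam G Z.
Proof.
move=> GE; exists (@sin R), (fun t => 1 - cos t), (@cos R); split=> //.
split; first split; [exact: normr_sin_le | split | split; [|split]].
- exact: normr_1cos_le.
- move=> t; have h : 1 <= expR `|t| by have := expR_ge1Dx `|t|; have := normr_ge0 t; lra.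
  by apply: le_trans h; rewrite ler_norml cos_geN1 cos_le1.
- exact: is_derive_sin.
- move=> t; rewrite -[sin t]opprK -[- - sin t]sub0r.
  exact: is_deriveB (is_derive_cst _ _ _) (is_derive_cos t).
- exact: derive_continuous (@is_derive_cos R).
Qed.

Lemma Kgen_sqr (k : 'I_4) : k != i3 -> Kgen k *m Kgen k = delta_mx k k + delta_mx i3 i3.
Proof.
move=> k3; rewrite /Kgen mulmxDl !mulmxDr !mul_delta_mx_cond eqxx eq_sym (negbTE k3) eqxx.
by rewrite !mulr0n !mulr1n addr0 add0r.
Qed.

Lemma Lgen_sqr (k l : 'I_4) : k != l ->
  Lgen k l *m Lgen k l = - delta_mx k k - delta_mx l l.
Proof.
move=> kl; rewrite /Lgen mulmxBl !mulmxBr !mul_delta_mx_cond eqxx (eq_sym l) (negbTE kl) eqxx.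
by rewrite !mulr0n !mulr1n sub0r subr0 addrC.
Qed.

Lemma oneparam_boost1 : oneparam (boost i1) (Kgen i1).
Proof.
apply: oneparam_hyperbolic => t; rewrite Kgen_sqr ?ord4_eqE // /boost /Kgen.
by move: (cosh t) (sinh t) => ? ?; mx4_entries; ring.
Qed.

Lemma oneparam_boost2 : oneparam (boost i2) (Kgen i2).
Proof.
apply: oneparam_hyperbolic => t; rewrite Kgen_sqr ?ord4_eqE // /boost /Kgen.
by move: (cosh t) (sinh t) => ? ?; mx4_entries; ring.
Qed.

Lemma oneparam_rot01 : oneparam (rot i0 i1) (Lgen i0 i1).
Proof.
apply: oneparam_elliptic => t; rewrite Lgen_sqr ?ord4_eqE // /Defs.rot /Lgen.
by move: (cos t) (sin t) => ? ?; mx4_entries; ring.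
Qed.

Lemma oneparam_rot02 : oneparam (rot i0 i2) (Lgen i0 i2).
Proof.
apply: oneparam_elliptic => t; rewrite Lgen_sqr ?ord4_eqE // /Defs.rot /Lgen.
by move: (cos t) (sin t) => ? ?; mx4_entries; ring.
Qed.

Definition twocosh x := expR x + expR (- x).
(** Adjoint action of the translation by [x] along the geodesic: it carries a move made at position
    [x] back to the reference frame. *)
Definition Adb x Z := boost i1 x *m Z *m boost i1 (- x).

Lemma twocosh_ge2 x : 2 <= twocosh x.
Proof.
rewrite /twocosh; have := expRxMexpNx_1 x; have := expR_gt0 x; have := expR_gt0 (- x).
by move: (expR x) (expR (- x)) => a b a0 b0 h; have := sqr_ge0 (a - b); nra.
Qed.

(** The two summands come from the linear and the quadratic term of the Rodrigues formula, for a
    generator of size [m]. *)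
Definition kap (m H : R) := expR H * (m + m ^+ 2 * H).

Lemma is_derive_mulr_cst (f : R -> R) t d k :
  is_derive t 1 f d -> is_derive t 1 (fun s => f s * k) (d * k).
Proof.
move=> h; have := is_deriveM h (is_derive_cst k t 1).
by move=> g; apply: is_derive_eq; rewrite scaler0 add0r /GRing.scale /= mulrC.
Qed.

(** Conjugation preserves the Rodrigues form and replaces [Z] by [Y = Adb x Z]. The norm of [Y *m Y]
    may grow like [twocosh x ^+ 2], but its coefficient is of order [w ^+ 2]; the bound
    [w * twocosh x <= H] absorbs one factor, so displacement and speed stay linear in
    [twocosh x]. *)
Lemma conj_oneparam_step (G : R -> 'M[R]_4) Z x a b w m H :
  0 <= m -> oneparam G Z -> (forall t, isomG (G t)) -> nm (Adb x Z) <= m * twocosh x ->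
  `|a| + `|b| <= w -> w * twocosh x <= H ->
  tame_step (fun t => Adb x (G (a + t * b))) (kap m H * (w * twocosh x))
    (kap m H * (`|b| * twocosh x)).
Proof.
move=> m0 [S [T [S' [GE [[Sb [Tb S'b]] [dS [dT cS']]]]]]] iG nZ abw wH.
set Y := Adb x Z in nZ *.
have E2 := twocosh_ge2 x.
have w0 : 0 <= w by apply: le_trans abw; rewrite addr_ge0.
have wleH : w <= H by apply: le_trans wH; rewrite ler_peMr //; lra.
have AE t : Adb x (G t) = 1%:M + S t *: Y + T t *: (Y *m Y).
  rewrite GE /Adb !mulmxDr !mulmxDl mulmx1 boost1N -!scalemxAr -!scalemxAl.
  congr (_ + _ + _ *: _).
  by rewrite /Y /Adb -!mulmxA (mulmxA (boost i1 (- x))) boost1Nl mul1mx.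
have nYY : nm (Y *m Y) <= m ^+ 2 * twocosh x ^+ 2.
  apply: (le_trans (nmM _ _)).
  rewrite (_ : m ^+ 2 * _ = (m * twocosh x) * (m * twocosh x)); last by ring.
  by apply: ler_pM; rewrite ?nm_ge0.
pose u t := a + t * b.
have du (t : R) : is_derive t (1 : R) u b.
  have := is_deriveD (is_derive_cst a t 1) (is_derive_mulr_cst b (is_derive_id t 1)).
  by rewrite add0r mul1r.
have cS : continuous S := derive_continuous dS.
have cu : continuous u := derive_continuous du.
exists (fun t => (S' (u t) * b) *: Y + (S (u t) * b) *: (Y *m Y)); split.
  move=> i j; split=> [t|].
    under eq_fun do rewrite AE !mxE.
    have dSu := is_derive_mulr_cst (Y i j) (is_derive1_comp (dS (u t)) (du t)).
    have dTu := is_derive_mulr_cst ((Y *m Y) i j) (is_derive1_comp (dT (u t)) (du t)).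
    have := is_deriveD (is_deriveD (is_derive_cst ((1%:M : 'M[R]_4) i j) t 1) dSu) dTu.
    by rewrite add0r !mxE.
  under eq_fun do rewrite !mxE.
  move=> t; apply: cvgD; apply: cvgM; try exact: cvg_cst.
    by apply: cvgM; [apply: continuous_comp; [exact: cu | exact: cS'] | exact: cvg_cst].
  by apply: cvgM; [apply: continuous_comp; [exact: cu | exact: cS] | exact: cvg_cst].
move=> t /andP[t0 t1].
have uw : `|u t| <= w.
  apply: le_trans abw; apply: (le_trans (ler_normD _ _)); rewrite lerD2l normrM.
  by rewrite ger0_norm // ler_piMl.
have eu : expR `|u t| <= expR H by rewrite ler_expR (le_trans uw).
have eH := expR_gt0 H.
have bS : `|S (u t)| <= w * expR H.
  by apply: (le_trans (Sb _)); apply: ler_pM; rewrite // expR_ge0.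
have bT : `|T (u t)| <= w ^+ 2 * expR H.
  apply: (le_trans (Tb _)); apply: ler_pM; rewrite // ?expR_ge0 ?sqr_ge0 //.
  by rewrite -real_normK ?num_real // ler_sqr ?nnegrE.
have bS' : `|S' (u t)| <= expR H by apply: (le_trans (S'b _)).
split.
- apply: isomG_mul; last exact: isomG_boost1.
  by apply: isomG_mul; [exact: isomG_boost1 | exact: iG].
- rewrite AE -(addrA 1%:M) addrAC subrr add0r.
  apply: (le_trans (nmD _ _)); rewrite !nmZ /kap.
  apply: (@le_trans _ _ (w * expR H * (m * twocosh x) +
    w ^+ 2 * expR H * (m ^+ 2 * twocosh x ^+ 2))).
    by apply: lerD; apply: ler_pM; rewrite ?nm_ge0.
  rewrite (_ : _ + _ = expR H * (m + m ^+ 2 * (w * twocosh x)) * (w * twocosh x));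
    last by ring.
  rewrite ler_wpM2r ?mulr_ge0 //; first lra.
  by apply: (ler_wpM2l (ltW eH)); rewrite lerD2l; apply: ler_wpM2l wH; exact: sqr_ge0.
- apply: (le_trans (nmD _ _)); rewrite !nmZ !normrM /kap.
  apply: (@le_trans _ _ (expR H * `|b| * (m * twocosh x) +
    w * expR H * `|b| * (m ^+ 2 * twocosh x ^+ 2))).
    by apply: lerD; apply: ler_pM; rewrite ?nm_ge0 ?mulr_ge0 // ler_wpM2r.
  rewrite (_ : _ + _ = expR H * (m + m ^+ 2 * (w * twocosh x)) * (`|b| * twocosh x));
    last by ring.
  rewrite ler_wpM2r ?mulr_ge0 //; first lra.
  by apply: (ler_wpM2l (ltW eH)); rewrite lerD2l; apply: ler_wpM2l wH; exact: sqr_ge0.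
Qed.

End OneParameter.

(** * Growth of the conjugated generators *)

Section Adjoint.
Context {R : realType}.
Implicit Types x : R.

Lemma nm_delta (k l : 'I_4) : nm (delta_mx k l : 'M[R]_4) <= 16.
Proof.
rewrite -[leRHS]mulr1; apply: nm_le => i j; rewrite mxE normr_nat.
by rewrite (ler_nat _ _ 1) leq_b1.
Qed.

Lemma nmN (X : 'M[R]_4) : nm (- X) = nm X.
Proof. by rewrite -scaleN1r nmZ normrN1 mul1r. Qed.

Lemma nm_deltaB (k l p q : 'I_4) : nm (delta_mx k l - delta_mx p q : 'M[R]_4) <= 32.
Proof.
apply: (le_trans (nmD _ _)); rewrite nmN.
by have := nm_delta k l; have := nm_delta p q; lra.
Qed.

Lemma nm_deltaD (k l p q : 'I_4) : nm (delta_mx k l + delta_mx p q : 'M[R]_4) <= 32.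
Proof.
apply: (le_trans (nmD _ _)).
by have := nm_delta k l; have := nm_delta p q; lra.
Qed.

(** The product has rank one: column [k] of [X] times row [l] of [Y]. *)
Lemma nm_mul_delta (X Y : 'M[R]_4) k l :
  nm (X *m delta_mx k l *m Y) = (\sum_i `|X i k|) * (\sum_j `|Y l j|).
Proof.
rewrite -(mul_delta_mx (0 : 'I_1)) mulmxA -colE -mulmxA -rowE /nm mulr_suml.
apply: eq_bigr => i _; rewrite mulr_sumr; apply: eq_bigr => j _.
by rewrite mxE big_ord1 !mxE normrM.
Qed.

Lemma boost1_colsum x :
  [/\ \sum_i `|boost i1 x i i0| <= 1, \sum_i `|boost i1 x i i2| <= 1,
      \sum_i `|boost i1 x i i1| <= twocosh x & \sum_i `|boost i1 x i i3| <= twocosh x].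
Proof.
have cs : `|cosh x| + `|sinh x| <= twocosh x.
  have [p q] := (expR_gt0 x, expR_gt0 (- x)).
  rewrite gtr0_norm ?cosh_gt0 // -lerBrDl ler_norml /cosh /sinh /twocosh.
  by apply/andP; split; lra.
rewrite !sum4 /boost; move: (cosh x) (sinh x) cs => a b ab.
by split; rewrite !mxE !(eqxx, ord4_eqE) /= ?normr0 ?normr1; lra.
Qed.

Lemma tr_boost k x : (boost k x)^T = boost k x.
Proof.
apply/matrixP => i j; rewrite !mxE (eq_sym j i).
by case: (i == k); case: (j == k); case: (i == i3); case: (j == i3).
Qed.

Lemma boost1_rowsum x :
  [/\ \sum_j `|boost i1 x i0 j| <= 1, \sum_j `|boost i1 x i2 j| <= 1,
      \sum_j `|boost i1 x i1 j| <= twocosh x & \sum_j `|boost i1 x i3 j| <= twocosh x].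
Proof.
have e i : \sum_j `|boost i1 x i j| = \sum_j `|boost i1 x j i|.
  by apply: eq_bigr => j _; rewrite -{1}tr_boost mxE.
by rewrite !e; exact: boost1_colsum.
Qed.

Lemma twocoshN x : twocosh (- x) = twocosh x.
Proof. by rewrite /twocosh opprK addrC. Qed.

Lemma nm_Adb_delta x (k l p q : 'I_4) c : `|c| = 1 ->
  nm (Adb x (delta_mx k l)) <= twocosh x -> nm (Adb x (delta_mx p q)) <= twocosh x ->
  nm (Adb x (delta_mx k l + c *: delta_mx p q)) <= 32 * twocosh x.
Proof.
move=> c1 h h'; rewrite /Adb mulmxDr mulmxDl -scalemxAr -scalemxAl.
apply: (le_trans (nmD _ _)); rewrite nmZ c1 mul1r; have := twocosh_ge2 x; move: h h'.
by rewrite /Adb; lra.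
Qed.

(** Each matrix unit in [Kgen i2] pairs the index [i2], fixed by [boost i1], with [i3], which is
    not. Only one of the two outer boosts contributes growth, hence [twocosh x] and not its square.
    The same happens for [Lgen i0 i1]. *)
Lemma nm_Adb_K2 x : nm (Adb x (Kgen i2)) <= 32 * twocosh x.
Proof.
have [_ c2 _ c3] := boost1_colsum x; have [_ r2 _ r3] := boost1_rowsum (- x).
rewrite twocoshN in r3.
have s0 (F : 'I_4 -> R) : 0 <= \sum_i `|F i| by exact: sumr_ge0.
rewrite /Kgen -[delta_mx i3 i2]scale1r; apply: nm_Adb_delta; rewrite ?normr1 //.
  by rewrite /Adb nm_mul_delta -[leRHS]mul1r ler_pM.
by rewrite /Adb nm_mul_delta -[leRHS]mulr1 ler_pM.
Qed.

Lemma nm_Adb_L01 x : nm (Adb x (Lgen i0 i1)) <= 32 * twocosh x.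
Proof.
have [c0 _ c1 _] := boost1_colsum x; have [r0 _ r1 _] := boost1_rowsum (- x).
rewrite twocoshN in r1.
have s0 (F : 'I_4 -> R) : 0 <= \sum_i `|F i| by exact: sumr_ge0.
rewrite /Lgen -scaleN1r; apply: nm_Adb_delta; rewrite ?normrN1 //.
  by rewrite /Adb nm_mul_delta -[leRHS]mulr1 ler_pM.
by rewrite /Adb nm_mul_delta -[leRHS]mul1r ler_pM.
Qed.

Lemma Adb0 (X : 'M[R]_4) : Adb 0 X = X.
Proof. by rewrite /Adb oppr0 boost10 mul1mx mulmx1. Qed.

Lemma twocosh0 : twocosh (0 : R) = 2.
Proof. by rewrite /twocosh oppr0 expR0; lra. Qed.

End Adjoint.

(** * The left-invariant distance *)

Section Distance.
Context {R : realType}.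
Context (A : 'M[R]_16).
Implicit Types X Y : 'M[R]_4.

Lemma lnorm_ge0 X : 0 <= lnorm A X.
Proof. exact: sqrtr_ge0. Qed.

Lemma lnorm_coord_le X k : `|(mxvec X *m A) 0 k| <= lnorm A X.
Proof.
rewrite /lnorm -sqrtr_sqr ler_sqrt; last by apply: sumr_ge0 => i _; exact: sqr_ge0.
rewrite (bigD1 (cast_ord (mul1n 16) k)) //=
  (_ : cast_ord (esym (mul1n 16)) (cast_ord (mul1n 16) k) = k) ?cast_ordK //.
by rewrite lerDl; apply: sumr_ge0 => i _; exact: sqr_ge0.
Qed.

Lemma lnorm_le : exists2 C : R, 0 < C & forall X, lnorm A X <= C * nm X.
Proof.
(* The 16 generously bounds the square root of the number of coordinates; adding 1 keeps [C]
   positive. *)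
pose C : R := 16 * (\sum_i \sum_j `|A i j|) + 1.
have S0 : 0 <= \sum_i \sum_j `|A i j| by apply: sumr_ge0 => i _; apply: sumr_ge0.
exists C => [|X]; first by rewrite /C; lra.
have yb k : `|(mxvec X *m A) 0 k| <= nm X * \sum_i \sum_j `|A i j|.
  rewrite mxE; apply: (le_trans (ler_norm_sum _ _ _)); rewrite mulr_sumr.
  apply: ler_sum => i _; rewrite normrM; apply: ler_pM => //.
    by case/mxvec_indexP: i => i j; rewrite mxvecE; exact: nm_entry.
  by rewrite (bigD1 k) //= lerDl; apply: sumr_ge0.
have y0 : 0 <= nm X * \sum_i \sum_j `|A i j| by rewrite mulr_ge0 // nm_ge0.
apply: (@le_trans _ _ (16 * (nm X * \sum_i \sum_j `|A i j|))); last first.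
  by rewrite /C (mulrC (nm X)) mulrA [leRHS]mulrDl mul1r lerDl nm_ge0.
have s0 : 0 <= 16 * (nm X * \sum_i \sum_j `|A i j|) by rewrite mulr_ge0.
rewrite -[leRHS]ger0_norm // -sqrtr_sqr /lnorm ler_sqrt ?sqr_ge0 //.
apply: (@le_trans _ _ (\sum_(j < 16) (nm X * \sum_i \sum_j `|A i j|) ^+ 2)).
  apply: ler_sum => j _; rewrite -real_normK ?num_real // ler_sqr ?nnegrE //; exact: yb.
rewrite sumr_const card_ord -[leLHS]mulr_natl [leRHS]exprMn ler_wpM2r ?sqr_ge0 //.
by rewrite expr2 ler_peMr // ler1n.
Qed.

(** Definiteness of the metric: the coordinates of [X] are recovered from [mxvec X *m A] through
    [invmx A]. *)
Lemma entry_le_lnorm : A \in unitmx ->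
  exists2 C : R, 0 < C & forall X i j, `|X i j| <= C * lnorm A X.
Proof.
move=> uA; pose S : R := \sum_i \sum_j `|invmx A i j|.
have S0 : 0 <= S by apply: sumr_ge0 => i _; apply: sumr_ge0.
exists (S + 1) => [|X i j]; first lra.
rewrite -(mxvecE X) -(mulmxK uA (mxvec X)) mxE.
apply: (le_trans (ler_norm_sum _ _ _)).
apply: (@le_trans _ _ (S * lnorm A X)); last by rewrite ler_wpM2r ?lnorm_ge0 //; lra.
rewrite mulr_suml; apply: ler_sum => k _; rewrite normrM mulrC; apply: ler_pM => //.
  by rewrite (bigD1 (mxvec_index i j)) //= lerDl; apply: sumr_ge0.
exact: lnorm_coord_le.
Qed.

Lemma continuous_sum (I : Type) (r : seq I) (F : I -> R -> R) :
  (forall i, continuous (F i)) -> continuous (fun t => \sum_(i <- r) F i t).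
Proof.
move=> h t; elim: r => [|i r IH].
  under eq_fun do rewrite big_nil.
  exact: cvg_cst.
under eq_fun do rewrite big_cons.
by apply: cvgD IH; exact: h.
Qed.

Lemma continuous_lnorm (X : R -> 'M[R]_4) :
  (forall i j, continuous (fun t => X t i j)) -> continuous (fun t => lnorm A (X t)).
Proof.
move=> h t; rewrite /lnorm.
apply: continuous_comp; last exact: sqrt_continuous.
apply: continuous_sum => j {}t; apply: cvgM; under eq_fun do rewrite mxE; rewrite mxE;
  apply: continuous_sum => k {}t; apply: cvgM; try exact: cvg_cst;
  case/mxvec_indexP: k => i l; under eq_fun do rewrite mxvecE; rewrite mxvecE; exact: h.
Qed.

Lemma continuous_integrable01 (f : R -> R) : {within `[0, 1], continuous f} ->
  lebesgue_measure.-integrable `[0, 1] (EFin \o f).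
Proof. by apply: continuous_compact_integrable; exact: segment_compact. Qed.

Lemma integral01_cst (M : R) : (\int[lebesgue_measure]_(t in `[0%R, 1%R]) M%:E)%E = M%:E.
Proof.
rewrite integral_cst //= lebesgue_measure_itv /= lte_fin ltr01 -EFinB subr0.
by rewrite mule1.
Qed.

Lemma speed_continuous c c' : path_deriv c c' ->
  continuous (fun t => lnorm A (jinv (c t) *m c' t)).
Proof.
move=> dc; apply: continuous_lnorm => i j t.
have cM k : (fun t => jinv (c t) i k * c' t k j) @ t --> jinv (c t) i k * c' t k j.
  have [_ h] := dc k j.
  by apply: cvgM; [exact: path_deriv_cont (path_deriv_jinv dc) _ | exact: h].
under eq_fun do rewrite mulmx4.
exact: cvgD (cvgD (cvgD (cM _) (cM _)) (cM _)) (cM _).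
Qed.

Lemma curve_lenE c c' : path_deriv c c' -> (forall t, unit_itv t -> isomG (c t)) ->
  curve_len A c =
  (\int[lebesgue_measure]_(t in `[0%R, 1%R]) (lnorm A (jinv (c t) *m c' t))%:E)%E.
Proof.
move=> dc ic; apply: eq_integral => t; rewrite inE /= in_itv /= => ht.
by rewrite (path_deriv_dcurve _ dc) invmx_isomG //; exact: ic.
Qed.

(** The distance is at most the length of [c]. In the speed, [jinv (c t)] has the same norm as
    [c t], which accounts for the square. *)
Lemma gdist_tame : exists2 C : R, 0 < C & forall (c : R -> 'M[R]_4) (N a b : R),
  0 <= N -> 0 <= b -> tame c N a b ->
  (gdist A (c 0%R) (c 1%R) <= (C * ((N * expR a) ^+ 2 * b))%:E)%E.
Proof.
have [C C0 hC] := lnorm_le; exists C => // c N a b N0 b0 [c' [dc hc]].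
have ic t : unit_itv t -> isomG (c t) by move=> /hc[].
apply: (@le_trans _ _ (curve_len A c)).
  apply: ereal_inf_lbound; exists c => //; split; first exact: path_deriv_C1 dc.
  by split=> //; split.
rewrite (curve_lenE dc ic) -[leRHS]integral01_cst; apply: le_integral => //.
- apply: continuous_integrable01; apply: continuous_subspaceT; exact: speed_continuous.
- by apply: continuous_integrable01; apply: continuous_subspaceT; exact: cst_continuous.
move=> t; rewrite inE /= in_itv /= => ht; rewrite lee_fin.
have [ict nc nc'] := hc t ht.
apply: (le_trans (hC _)); rewrite ler_wpM2l ?(ltW C0) //.
apply: (le_trans (nmM _ _)); rewrite nm_jinv expr2 -mulrA.
by apply: ler_pM; rewrite ?nm_ge0.
Qed.

(** Take a curve of length below [D] and let [f] be its lower right entry. Writing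
    [c' = c *m (jinv c *m c')] and bounding the four entries of row 3 of [c] by [f] gives
    [f' / f <= 4 * C * sp]; integrating [ln f] from [f 0 = 1] concludes. *)
Lemma gdist_lt_entry33 : A \in unitmx ->
  exists2 C : R, 0 < C & forall g D, (gdist A 1%:M g < D%:E)%E -> g i3 i3 <= expR (C * D).
Proof.
move=> uA; have [C C0 hC] := entry_le_lnorm uA; exists (4 * C) => [|g D]; first lra.
move=> /ereal_inf_lt[_ [c [/path_derivP dc [c0 [c1 ic]]] <-]].
rewrite (curve_lenE dc ic); set c' := dcurve c in dc *.
pose sp t := lnorm A (jinv (c t) *m c' t).
have csp : continuous sp by exact: speed_continuous.
pose f t := c t i3 i3; pose f' t := c' t i3 i3.
have [df cf'] := dc i3 i3.
have f0 t : unit_itv t -> 0 < f t by move=> /ic[_ []].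
have f'b t : unit_itv t -> f' t / f t <= 4 * C * sp t.
  move=> ht; rewrite ler_pdivrMr ?f0 //.
  have -> : f' t = (c t *m (jinv (c t) *m c' t)) i3 i3.
    by rewrite mulmxA mul_isomG_jinv ?mul1mx //; exact: ic.
  rewrite mulmx4; apply: (le_trans (ler_norm _)).
  have e k : `|c t i3 k * (jinv (c t) *m c' t) k i3| <= f t * (C * sp t).
    by rewrite normrM; apply: ler_pM => //; exact/isomG_row3_le/ic.
  have [[e0 e1] [e2 e3]] := ((e i0, e i1), (e i2, e i3)).
  rewrite (_ : 4 * C * sp t * f t = f t * (C * sp t) + f t * (C * sp t)
    + f t * (C * sp t) + f t * (C * sp t)); last by ring.
  apply: (le_trans (ler_normD _ _)); apply: lerD => //.
  apply: (le_trans (ler_normD _ _)); apply: lerD => //.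
  by apply: (le_trans (ler_normD _ _)); apply: lerD.
have cf : continuous f by exact: path_deriv_cont dc.
have u0 : unit_itv (0 : R) by rewrite /unit_itv lexx ler01.
have u1 : unit_itv (1 : R) by rewrite /unit_itv lexx ler01.
have cln t : unit_itv t -> ln (f s) @[s --> t] --> ln (f t).
  by move=> ht; apply: continuous_comp; [exact: cf | apply: continuous_ln; exact: f0].
have dln t : unit_itv t -> is_derive t 1 (@ln R \o f) ((f t)^-1 * f' t).
  by move=> ht; apply: is_derive1_comp => //; exact/is_derive1_ln/f0.
have ch : {within `[0, 1], continuous (fun t => f' t / f t)}.
  apply: continuous_in_subspaceT => t; rewrite inE /= in_itv /= => ht.
  apply: cvgM; first exact: cf'.
  by apply: cvgV; [rewrite gt_eqF ?f0 | exact: cf].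
have ftc : (\int[lebesgue_measure]_(t in `[0%R, 1%R]) (f' t / f t)%:E)%E =
    ((ln (f 1))%:E - (ln (f 0))%:E)%E.
  apply: (@continuous_FTC2 _ _ (@ln R \o f)) => //.
    split; [|by apply: cvg_at_right_filter; exact: cln
      |by apply: cvg_at_left_filter; exact: cln].
    move=> t; rewrite in_itv /= => /andP[t0 t1].
    by have [] := dln t; rewrite /unit_itv ?(ltW t0) ?(ltW t1).
  move=> t; rewrite in_itv /= => /andP[t0 t1].
  have ht : unit_itv t by rewrite /unit_itv (ltW t0) (ltW t1).
  by rewrite derive1E (@derive_val _ _ _ _ _ _ _ (dln t ht)) mulrC.
move=> hD.
have isp : lebesgue_measure.-integrable `[0, 1] (EFin \o sp).
  by apply: continuous_integrable01; apply: continuous_subspaceT.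
have : ((ln (f 1))%:E - (ln (f 0))%:E <= (4 * C * D)%:E)%E.
  rewrite -ftc; apply: (@le_trans _ _
    (\int[lebesgue_measure]_(t in `[0%R, 1%R]) ((4 * C)%:E * (EFin \o sp) t))%E).
    apply: le_integral => //.
    - exact: continuous_integrable01.
    - exact: integrableZl.
    - by move=> t; rewrite inE /= in_itv /= => ht; rewrite -EFinM lee_fin f'b.
  rewrite integralZl // [leRHS]EFinM; apply: lee_wpmul2l (ltW hD).
  by rewrite lee_fin mulr_ge0 // ltW.
rewrite /f c0 c1 mxE eqxx ln1 -EFinB lee_fin subr0 => h.
by rewrite -(@lnK _ (g i3 i3)) ?ler_expR // posrE -c1; exact: f0.
Qed.

End Distance.

(** * Light-cone estimates *)

Section Geometry.
Context {R : realType}.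
Implicit Types (F u r : 'M[R]_4) (s t x y : R).

(** Such an [r] fixes the base point: the remaining entries of its last row and column have
    vanishing sums of squares. *)
Lemma isomG_fix3 r k : isomG r -> r i3 i3 = 1 -> k != i3 ->
  r k i3 = 0 /\ r i3 k = 0.
Proof.
move=> ir r33.
have h := isomG_row3 ir; have h' := isomG_col3 ir; rewrite r33 expr1n in h h'.
have sq0 (a b c : R) : 1 = 1 + a ^+ 2 + b ^+ 2 + c ^+ 2 -> [/\ a = 0, b = 0 & c = 0].
  move=> e; have [[pa pb] pc] := (sqr_ge0 a, sqr_ge0 b, sqr_ge0 c).
  by split; apply/eqP; rewrite -sqrf_eq0; apply/eqP; lra.
have [c0 c1 c2] := sq0 _ _ _ h; have [d0 d1 d2] := sq0 _ _ _ h'.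
by move: k; refine (@ord4_ind _ _ _ _ _) => //; rewrite eqxx.
Qed.

Lemma nm_fix3 r : isomG r -> r i3 i3 = 1 -> nm r <= 16.
Proof.
move=> ir r33; rewrite -[leRHS]mulr1; apply: nm_le => i j.
have [->|i3j] := eqVneq j i3.
  have [->|/(isomG_fix3 ir r33)[-> _]] := eqVneq i i3; first by rewrite r33 normr1.
  by rewrite normr0.
have [->|i3i] := eqVneq i i3.
  by have [_ ->] := isomG_fix3 ir r33 i3j; rewrite normr0.
have := isomG_row ir => /matrixP/(_ i i); rewrite !mulmx4 !mxE ?(ord4_eqE, eqxx) /=.
rewrite (negbTE i3i) (isomG_fix3 ir r33 i3i).1 !(mulr0, mul0r, mulr1, addr0, add0r).
move: i3j; have [[p q] w] := (sqr_ge0 (r i i0), sqr_ge0 (r i i1), sqr_ge0 (r i i2)).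
move: j; refine (@ord4_ind _ _ _ _ _) => //; last by rewrite eqxx.
all: by move=> _ e; apply: normr_le_sqr => //; rewrite expr1n; lra.
Qed.

Lemma gpt_shift (g : ogeod R) t t0 :
  gpt g t = cosh (t - t0) *: gpt g t0 + sinh (t - t0) *: gtan g t0.
Proof.
have ch : cosh t = cosh (t - t0) * cosh t0 + sinh (t - t0) * sinh t0.
  by rewrite -coshD subrK.
have sh : sinh t = sinh (t - t0) * cosh t0 + cosh (t - t0) * sinh t0.
  by rewrite -sinhD subrK.
rewrite /gpt /gtan ch sh.
move: (cosh (t - t0)) (sinh (t - t0)) (cosh t0) (sinh t0) => p q p0 q0.
by apply/matrixP => i j; rewrite !mxE; ring.
Qed.

(** Translate [F] along [g] to the base point of [u]; what remains fixes the base point and so has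
    bounded norm. *)
Lemma Fr_decomp (g : ogeod R) F u : Fr g F -> Fr g u ->
  exists s r, [/\ u = F *m boost i1 s *m r, isomG r & r i3 i3 = 1].
Proof.
move=> [iF [t0 [Fp Fw]]] [iu [t [up _]]].
pose s := t - t0; pose h := invmx F *m u; pose r := boost i1 (- s) *m h.
have ih : isomG h by apply: isomG_mul => //; exact: isomG_invmx.
exists s, r; split.
- rewrite /r /h -mulmxA (mulmxA (boost i1 s)) boost1N mul1mx mulmxA mulmxV ?mul1mx //.
  exact: isomG_unit.
- by apply: isomG_mul => //; exact: isomG_boost1.
(* Column 3 of [h] is the base point of [u] seen from [F], a point of the axis of [boost i1]. *)
have hc : col i3 h = cosh s *: delta_mx i3 0 + sinh s *: delta_mx i1 0.
  have -> : col i3 h = invmx F *m frame_pt u by rewrite /h /frame_pt !colE mulmxA.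
  rewrite up (gpt_shift g t t0) -Fp -Fw /frame_pt /frame_w mulmxDr -!scalemxAr.
  by rewrite !colE !mulmxA mulVmx ?mul1mx // isomG_unit.
have h3 : h i3 i3 = cosh s.
  by move/matrixP/(_ i3 0): hc; rewrite !mxE !(eqxx, ord4_eqE) mulr1 mulr0 addr0.
have h1 : h i1 i3 = sinh s.
  by move/matrixP/(_ i1 0): hc; rewrite !mxE !(eqxx, ord4_eqE) mulr1 mulr0 add0r.
rewrite /r mulmx4 h3 h1 !mxE !(eqxx, ord4_eqE) /= !mul0r coshN sinhN add0r addr0.
by have := cosh_sub_sinh s; move: (cosh s) (sinh s) => a b; lra.
Qed.

(** Null coordinates, in which [boost i1 x] acts diagonally by [expR x] and [expR (- x)]. *)
Definition Xp (z : 'cV[R]_4) := z i3 0 + z i1 0.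
Definition Xm (z : 'cV[R]_4) := z i3 0 - z i1 0.

Lemma boost1_act x (z : 'cV[R]_4) :
  [/\ Xp (boost i1 x *m z) = expR x * Xp z, Xm (boost i1 x *m z) = expR (- x) * Xm z
    & (boost i1 x *m z) i2 0 = z i2 0].
Proof.
have [e1 e2] : expR x = cosh x + sinh x /\ expR (- x) = cosh x - sinh x.
  by rewrite /cosh /sinh; split; field.
rewrite /Xp /Xm e1 e2 /boost; move: (cosh x) (sinh x) => a b.
by split; rewrite !mulmx4 !mxE !(eqxx, ord4_eqE) /=; ring.
Qed.

Lemma boost2_act x (z : 'cV[R]_4) (m := (cosh x - 1) * ((Xp z + Xm z) / 2) + sinh x * z i2 0) :
  [/\ Xp (boost i2 x *m z) = Xp z + m, Xm (boost i2 x *m z) = Xm z + m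
    & (boost i2 x *m z) i2 0 = cosh x * z i2 0 + sinh x * ((Xp z + Xm z) / 2)].
Proof.
rewrite /m /Xp /Xm /boost; move: (cosh x) (sinh x) => a b.
by split; rewrite !mulmx4 !mxE !(eqxx, ord4_eqE) /=; field.
Qed.

Lemma cosh_ge1 x : 1 <= cosh x.
Proof. by have := twocosh_ge2 x; rewrite /twocosh /cosh; lra. Qed.

Lemma sinh_ge x : 0 <= x -> x <= sinh x.
Proof.
move=> x0; have cS : {within `[0, x], continuous (@sinh R)}.
  by apply: derivable_within_continuous => t _; have [] := is_derive_sinh t.
have [c _] := MVT_segment x0 (fun t _ => is_derive_sinh t) cS.
by rewrite sinh0 !subr0 => ->; rewrite ler_peMl // cosh_ge1.
Qed.

(* In the light-cone coordinates [Xp], [Xm] the conjugated boosts are positive matrices. *)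
Lemma cone_step x l (z : 'cV[R]_4) (z' := Adb x (boost i2 l) *m z) :
  0 <= l -> 0 <= Xp z -> 0 <= Xm z -> 0 <= z i2 0 ->
  [/\ Xp z <= Xp z', Xm z <= Xm z'
    & z i2 0 + l * ((expR (- x) * Xp z + expR x * Xm z) / 2) <= z' i2 0].
Proof.
move=> l0 p0 m0 q0.
rewrite /z' /Adb -!mulmxA.
have [a1 a2 a3] := boost1_act (- x) z; rewrite opprK in a2.
set w := boost i1 (- x) *m z in a1 a2 a3 *.
have [b1 b2 b3] := boost2_act l w.
have [-> -> ->] := boost1_act x (boost i2 l *m w).
rewrite b1 b2 b3 a1 a2 a3.
have ex := expR_gt0 x; have ey := expR_gt0 (- x).
have exy := expRxMexpNx_1 x.
have c1 := cosh_ge1 l; have s1 := sinh_ge l0.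
move: (cosh l) (sinh l) (expR x) (expR (- x)) c1 s1 ex ey exy => c s e f c1 s1 ex ey exy.
have T0 : 0 <= (f * Xp z + e * Xm z) / 2.
  by rewrite divr_ge0 // addr_ge0 // mulr_ge0 // ltW.
have M0 : 0 <= (c - 1) * ((f * Xp z + e * Xm z) / 2) + s * z i2 0.
  by rewrite addr_ge0 ?mulr_ge0 //; lra.
split.
- rewrite mulrDr mulrA exy mul1r lerDl; apply: mulr_ge0 => //; exact: ltW.
- rewrite mulrDr mulrA (mulrC f) exy mul1r lerDl; apply: mulr_ge0 => //; exact: ltW.
- by apply: lerD; [rewrite ler_peMl | rewrite ler_wpM2r].
Qed.

(** Induction from the far end: no crossing decreases [Xp] or [Xm], so they stay above [expR y] and
    [expR (- y)], and each crossing adds a definite positive amount to coordinate [i2]. *)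
Lemma cone_chain n y (z : nat -> 'cV[R]_4) (l x : nat -> R) :
  Xp (z n) = expR y -> Xm (z n) = expR (- y) -> z n i2 0 = 0 ->
  (forall k, (k < n)%N -> 0 <= l k /\ z k = Adb (x k) (boost i2 (l k)) *m z k.+1) ->
  [/\ expR y <= Xp (z 0%N), expR (- y) <= Xm (z 0%N)
    & \sum_(k < n) l k * ((expR (- x k) * expR y + expR (x k) * expR (- y)) / 2)
      <= z 0%N i2 0].
Proof.
elim: n z l x => [|n IH] z l x zp zm z2 hz.
  by rewrite big_ord0 zp zm z2 !lexx.
have [|h1 h2 h3] := IH (fun k => z k.+1) (fun k => l k.+1) (fun k => x k.+1) zp zm z2.
  by move=> k kn; exact: (hz k.+1).
have [l0 z0] := hz 0%N isT.
have ey := expR_gt0 y; have ey' := expR_gt0 (- y).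
have q0 : 0 <= z 1%N i2 0.
  apply: le_trans h3; apply: sumr_ge0 => k _; apply: mulr_ge0.
    by have [] := hz k.+1 (ltn_ord k).
  by rewrite divr_ge0 // addr_ge0 // mulr_ge0 ?expR_ge0.
have [k1 k2 k3] := cone_step (x 0%N) l0 (le_trans (ltW ey) h1) (le_trans (ltW ey') h2) q0.
rewrite -z0 in k1 k2 k3; split; [exact: le_trans k1 | exact: le_trans k2 |].
apply: le_trans k3; rewrite big_ord_recl /= addrC; apply: lerD => //.
rewrite ler_wpM2l // ler_wpM2r ?invr_ge0 //; apply: lerD; rewrite ler_wpM2l ?expR_ge0 //.
Qed.

Lemma chain_bound n y C (z : nat -> 'cV[R]_4) (l x : nat -> R) :
  Xp (z n) = expR y -> Xm (z n) = expR (- y) -> z n i2 0 = 0 ->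
  (forall k, (k < n)%N -> 0 <= l k /\ z k = Adb (x k) (boost i2 (l k)) *m z k.+1) ->
  z 0%N i3 0 <= C -> z 0%N i2 0 <= C -> `|z 0%N i1 0| <= C ->
  twocosh y <= 4 * C /\ \sum_(k < n) l k * twocosh (x k) <= 4 * C ^+ 2.
Proof.
move=> zp zm z2 hz c3 c2 /ler_normlP[c1 c1'].
have [p m s] := cone_chain zp zm z2 hz.
rewrite /Xp /Xm in p m.
have yC : expR y <= 2 * C by apply: (le_trans p); lra.
have yC' : expR (- y) <= 2 * C by apply: (le_trans m); lra.
have ey := expR_gt0 y; have ey' := expR_gt0 (- y).
have C0 : 0 < C by lra.
split; first by rewrite /twocosh; lra.
have {}s := le_trans s c2.
rewrite (_ : 4 * C ^+ 2 = 4 * C * C); last by ring.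
apply: le_trans (ler_wpM2l _ s); last by lra.
rewrite mulr_sumr; apply: ler_sum => k _.
have [l0 _] := hz k (ltn_ord k).
rewrite mulrCA; apply: ler_wpM2l => //.
have exy := expRxMexpNx_1 y.
have ex := expR_gt0 (x k); have ex' := expR_gt0 (- x k).
(* The upper bound on each of [expR y], [expR (- y)] is a lower bound on the other; this removes the
   weights in [y] from the sum. *)
have g1 : 1 <= 2 * C * expR y by rewrite -[leLHS]exy mulrC ler_wpM2r ?expR_ge0.
have g2 : 1 <= 2 * C * expR (- y) by rewrite -[leLHS]exy ler_wpM2r ?expR_ge0.
rewrite (_ : 4 * C * _ = expR (- x k) * (2 * C * expR y) +
  expR (x k) * (2 * C * expR (- y))); last by field.
by rewrite /twocosh addrC; apply: lerD; rewrite ler_peMr // ltW.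
Qed.

(** Only the first and last crossings matter: they bound [expR s] and [expR (n%:R - s)] by
    [B * expR (RR / 2) * C], and the product of the two bounds [expR n%:R], whatever [s] is. *)
Lemma chain_length (n : nat) RR B C s (l : nat -> R) : 0 < B ->
  (forall k, (k < n.+1)%N -> B^-1 < l k * expR (RR / 2)) ->
  \sum_(k < n.+1) l k * twocosh (k%:R - s) <= C ->
  n%:R <= RR + (B * C) ^+ 2.
Proof.
move=> B0 hl hS.
have l0 k : (k < n.+1)%N -> 0 < l k.
  move=> /hl h; have : 0 < l k * expR (RR / 2) by apply: lt_trans h; rewrite invr_gt0.
  by rewrite pmulr_lgt0 // expR_gt0.
have term (k : 'I_n.+1) : l k * twocosh (k%:R - s) <= C.
  apply: le_trans hS; rewrite (bigD1 k) //= lerDl; apply: sumr_ge0 => i _.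
  by rewrite mulr_ge0 ?(ltW (l0 _ _)) // /twocosh addr_ge0 ?expR_ge0.
have e2 := expR_gt0 (RR / 2).
have lo k a : (k < n.+1)%N -> expR a <= twocosh (k%:R - s) -> expR a <= B * expR (RR / 2) * C.
  move=> kn ha; have := term (Ordinal kn); rewrite /= => tk.
  have := hl k kn; rewrite -ltr_pdivrMr // => /ltW lk.
  have e : B^-1 / expR (RR / 2) * expR a <= C.
    apply: le_trans tk; apply: ler_pM; rewrite ?expR_ge0 //.
    by rewrite divr_ge0 ?invr_ge0 // ltW.
  rewrite -invfM mulrC ler_pdivrMr ?mulr_gt0 // in e.
  by rewrite mulrC.
have h1 : expR s <= B * expR (RR / 2) * C.
  by apply: (lo 0%N) => //; rewrite /twocosh sub0r opprK lerDr expR_ge0.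
have h2 : expR (n%:R - s) <= B * expR (RR / 2) * C.
  by apply: (lo n) => //; rewrite /twocosh lerDl expR_ge0.
have h3 : expR n%:R <= expR RR * (B * C) ^+ 2.
  rewrite (_ : n%:R = s + (n%:R - s)); last by ring.
  rewrite expRD (_ : expR RR = expR (RR / 2) * expR (RR / 2)); last first.
    by rewrite -expRD; congr expR; field.
  rewrite (_ : _ * (B * C) ^+ 2 = (B * expR (RR / 2) * C) * (B * expR (RR / 2) * C)).
    by apply: ler_pM; rewrite ?expR_ge0.
  by ring.
have h4 : expR (n%:R - RR) <= (B * C) ^+ 2.
  by rewrite expRB ler_pdivrMr ?expR_gt0 // mulrC.
have := expR_ge1Dx (n%:R - RR); lra.
Qed.

Lemma nm_boost1 y : nm (boost i1 y) <= 16 * twocosh y.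
Proof.
have E2 := twocosh_ge2 y.
have [p q] := (expR_gt0 y, expR_gt0 (- y)).
apply: nm_le => i j; rewrite mxE.
case: ifP => _; first by rewrite gtr0_norm ?cosh_gt0 // /cosh /twocosh; lra.
case: ifP => _; first by rewrite /sinh /twocosh ler_norml; apply/andP; split; lra.
by case: ifP => _; rewrite ?normr1 ?normr0; lra.
Qed.

End Geometry.

(** * The interpolating curve *)

Section Chain.
Context {R : realType}.
Implicit Types (c f : R -> 'M[R]_4) (s t x y : R).

Lemma cabs_ge (a b : R) : `|a| <= cabs a b /\ `|b| <= cabs a b.
Proof.
rewrite /cabs -!sqrtr_sqr !ler_sqrt ?addr_ge0 ?sqr_ge0 //.
by rewrite lerDl lerDr !sqr_ge0.
Qed.

Lemma tame_step_le f (a b a' b' : R) :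
  a <= a' -> b <= b' -> tame_step f a b -> tame_step f a' b'.
Proof.
move=> aa bb [f' [df hf]]; exists f'; split=> // t /hf[jf h2 h3]; split=> //.
  exact: le_trans aa.
exact: le_trans bb.
Qed.

Lemma tame_le c (N a b N' a' b' : R) : 0 <= N -> 0 <= b ->
  N <= N' -> a <= a' -> b <= b' -> tame c N a b -> tame c N' a' b'.
Proof.
move=> N0 b0 NN aa bb [c' [dc hc]]; exists c'; split=> // t /hc[ic h2 h3].
have e : N * expR a <= N' * expR a' by apply: ler_pM; rewrite ?expR_ge0 // ler_expR.
split=> //; first exact: le_trans e.
apply: (le_trans h3); apply: ler_pM => //.
by rewrite mulr_ge0 // expR_ge0.
Qed.

Lemma kap_ge0 (m H : R) : 0 <= m -> 0 <= H -> 0 <= kap m H.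
Proof. by move=> m0 H0; rewrite /kap mulr_ge0 ?expR_ge0 // addr_ge0 // mulr_ge0 ?sqr_ge0. Qed.

(** A boost and a rotation, each with parameter at most [2 * l] because [eps <= 1], give the factor
    4; their speeds are at most [eps * l], giving the factor 2. *)
Lemma tame_crossing c (N a b x l l' th eps H : R) :
  0 <= N -> 0 <= b -> 0 <= l -> eps <= 1 -> cabs (l' - l) th < eps * l ->
  2 * (l * twocosh x) <= H -> tame c N a b ->
  tame (fun t => c t *m Adb x (boost i2 (l + t * (l' - l))) *m Adb x (rot i0 i1 (0 + t * th)))
    N (a + 4 * kap 32 H * (l * twocosh x)) (b + 2 * kap 32 H * (eps * (l * twocosh x))).
Proof.
move=> N0 b0 l0 e1 hc hH ht; have [h1 h2] := cabs_ge (l' - l) th.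
have E2 := twocosh_ge2 x.
have E0 : 0 <= twocosh x by lra.
have {}h1 := le_trans h1 (ltW hc); have {}h2 := le_trans h2 (ltW hc).
have el : eps * l <= l by rewrite ler_piMl.
have lE : 0 <= l * twocosh x by rewrite mulr_ge0.
have el0 : 0 <= eps * l by apply: le_trans h2.
have H0 : 0 <= H by lra.
have k0 : 0 <= kap 32 H by apply: kap_ge0.
have wH : 2 * l * twocosh x <= H by rewrite -mulrA.
have m0 : (0 : R) <= 32 by [].
have w1 : `|l| + `|l' - l| <= 2 * l by rewrite ger0_norm //; lra.
have w2 : `|0 : R| + `|th| <= 2 * l by rewrite normr0; lra.
have S1 := conj_oneparam_step m0 oneparam_boost2 (@isomG_boost2 R) (nm_Adb_K2 x) w1 wH.
have S2 := conj_oneparam_step m0 oneparam_rot01 (@isomG_rot01 R) (nm_Adb_L01 x) w2 wH.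
have S1' := tame_step_le (lexx _) (ler_wpM2l k0 (ler_wpM2r E0 h1)) S1.
have S2' := tame_step_le (lexx _) (ler_wpM2l k0 (ler_wpM2r E0 h2)) S2.
have p1 : 0 <= kap 32 H * (2 * l * twocosh x) by rewrite mulr_ge0 // mulr_ge0 // mulr_ge0.
have p2 : 0 <= kap 32 H * (eps * l * twocosh x) by rewrite mulr_ge0 // mulr_ge0.
have := tameM N0 (addr_ge0 b0 p2) p1 p2 (tameM N0 b0 p1 p2 ht S1') S2'.
by apply: tame_le => //; rewrite ?addr_ge0 //; lra.
Qed.

(** Only the excess [p] of a slide over its reference length is interpolated, so [d] bounds both
    displacement and speed. Writing the factors with [Adb 0] reuses the crossing estimate, with
    [twocosh 0 = 2]. *)
Lemma tame_sliding c (N a b p th d H : R) :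
  0 <= N -> 0 <= b -> cabs p th < d -> 2 * d <= H -> tame c N a b ->
  tame (fun t => c t *m Adb 0 (boost i1 (0 + t * p)) *m Adb 0 (rot i0 i2 (0 + t * th)))
    N (a + 4 * kap 32 H * d) (b + 4 * kap 32 H * d).
Proof.
move=> N0 b0 hc hH ht; have [h1 h2] := cabs_ge p th.
have {}h1 := le_trans h1 (ltW hc); have {}h2 := le_trans h2 (ltW hc).
have d0 : 0 <= d by apply: le_trans h2.
have H0 : 0 <= H by lra.
have k0 : 0 <= kap 32 H by apply: kap_ge0.
have m0 : (0 : R) <= 32 by [].
have wH : d * twocosh 0 <= H by rewrite twocosh0 mulrC.
have w1 : `|0 : R| + `|p| <= d by rewrite normr0 add0r.
have w2 : `|0 : R| + `|th| <= d by rewrite normr0 add0r.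
have n1 : nm (Adb 0 (Kgen i1)) <= 32 * twocosh (0 : R).
  by rewrite Adb0 twocosh0; apply: (le_trans (nm_deltaD _ _ _ _)); lra.
have n2 : nm (Adb 0 (Lgen i0 i2)) <= 32 * twocosh (0 : R).
  by rewrite Adb0 twocosh0; apply: (le_trans (nm_deltaB _ _ _ _)); lra.
have S1 := conj_oneparam_step m0 oneparam_boost1 (@isomG_boost1 R) n1 w1 wH.
have S2 := conj_oneparam_step m0 oneparam_rot02 (@isomG_rot02 R) n2 w2 wH.
have E0 : 0 <= twocosh (0 : R) by rewrite twocosh0.
have S1' := tame_step_le (lexx _) (ler_wpM2l k0 (ler_wpM2r E0 h1)) S1.
have S2' := tame_step_le (lexx _) (ler_wpM2l k0 (ler_wpM2r E0 h2)) S2.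
have p1 : 0 <= kap 32 H * (d * twocosh 0) by rewrite mulr_ge0 // mulr_ge0.
have := tameM N0 (addr_ge0 b0 p1) p1 p1 (tameM N0 b0 p1 p1 ht S1') S2'.
by apply: tame_le => //; rewrite ?addr_ge0 // twocosh0; lra.
Qed.

Lemma Adb_cross x (W X Y : 'M[R]_4) :
  W *m boost i1 (- x) *m Adb x X *m Adb x Y = W *m X *m Y *m boost i1 (- x).
Proof.
rewrite /Adb !mulmxA -(mulmxA W) boost1Nl mulmx1.
by rewrite -(mulmxA (W *m X)) boost1Nl mulmx1.
Qed.

Lemma cross_end x (V c W X Y : 'M[R]_4) : V *m c = W *m boost i1 (- x) ->
  V *m (c *m Adb x X *m Adb x Y) = W *m X *m Y *m boost i1 (- x).
Proof. by move=> h; rewrite !(mulmxA V) h Adb_cross. Qed.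

Lemma slide_end (V c W X Y : 'M[R]_4) : V *m c = W ->
  V *m (c *m Adb 0 X *m Adb 0 Y) = W *m X *m Y.
Proof. by move=> h; rewrite !Adb0 !(mulmxA V) h. Qed.

Definition matched_slide (RR eps : R) (n : nat) (Fo Fi Fo' Fi' : nat -> 'M[R]_4) :=
  forall i, (0 < i < n)%N -> Fo i = Fi i *m boost i1 1 /\
    exists t th, Fo' i = Fi' i *m boost i1 t *m rot i0 i2 th /\ cabs (t - 1) th < eps / RR.

(** The crossing lengths, existential in [well_matched], are here a given function, so that sums
    over them can be formed. *)
Definition matched_cross (eps : R) (n : nat) (l : nat -> R) (Fo Fi Fo' Fi' : nat -> 'M[R]_4) :=
  forall i, (i < n)%N -> Fi i.+1 = Fo i *m boost i2 (l i) /\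
    exists l' th', Fi' i.+1 = Fo' i *m boost i2 l' *m rot i0 i1 th' /\
      cabs (l' - l i) th' < eps * l i.

(* The curve interpolates linearly all the complex distances of the two sequences. *)
Lemma chain_curve (n : nat) (RR eps s H : R) (l : nat -> R)
    (Fo Fi Fo' Fi' : nat -> 'M[R]_4) r :
  isomG r -> r i3 i3 = 1 -> 0 <= eps -> eps <= 1 -> 0 < RR ->
  matched_slide RR eps n Fo Fi Fo' Fi' -> matched_cross eps n l Fo Fi Fo' Fi' ->
  (forall i, (i < n)%N -> 0 <= l i /\ 2 * (l i * twocosh (i%:R - s)) <= H) ->
  2 * (eps / RR) <= H ->
  forall k, (k < n)%N -> exists c, [/\
    tame c 16
      (4 * kap 32 H * (\sum_(i < k.+1) l i * twocosh (i%:R - s)) +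
       k%:R * (4 * kap 32 H * (eps / RR)))
      (2 * kap 32 H * (eps * \sum_(i < k.+1) l i * twocosh (i%:R - s)) +
       k%:R * (4 * kap 32 H * (eps / RR))),
    Fo 0%N *m boost i1 s *m r *m c 0 = Fi k.+1 *m boost i1 (s - k%:R) &
    Fo' 0%N *m boost i1 s *m r *m c 1 = Fi' k.+1 *m boost i1 (s - k%:R)].
Proof.
move=> ir r33 e0 e1 RR0 hs hc hl hH.
have N0 : (0 : R) <= 16 by [].
have d0 : 0 <= eps / RR by rewrite divr_ge0 // ltW.
have H0 : 0 <= H by lra.
have k0 : 0 <= kap 32 H by apply: kap_ge0.
have lE i : (i < n)%N -> 0 <= l i * twocosh (i%:R - s).
  by move=> /hl[h _]; rewrite mulr_ge0 // (le_trans _ (twocosh_ge2 _)).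
have k2 : 0 <= 2 * kap 32 H by lra.
have b1 : 0 <= 4 * kap 32 H * (eps / RR) by apply: mulr_ge0 => //; lra.
elim=> [|k IH] kn.
  have [h1 [l' [th [h2 h3]]]] := hc 0%N kn; have [l0 hl0] := hl 0%N kn.
  (* The curve starts with the constant [jinv r], cancelling the rotation in the frame [u]. *)
  have ri : tame (fun=> jinv r) 16 0 0.
    by apply: tame_cst; [exact: isomG_jinv | rewrite nm_jinv nm_fix3].
  have T := tame_crossing N0 (lexx 0) l0 e1 h3 hl0 ri.
  have G (W : 'M[R]_4) : W *m boost i1 s *m r *m jinv r = W *m boost i1 (- (0%:R - s)).
    by rewrite -(mulmxA (W *m _)) mul_isomG_jinv // mulmx1 opprB subr0.
  have u0 : l 0%N + 0 * (l' - l 0%N) = l 0%N by ring.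
  have u1 : l 0%N + 1 * (l' - l 0%N) = l' by ring.
  exists (fun t => jinv r *m Adb (0%:R - s) (boost i2 (l 0%N + t * (l' - l 0%N))) *m
    Adb (0%:R - s) (rot i0 i1 (0 + t * th))); split.
  - have b0 := addr_ge0 (lexx 0) (mulr_ge0 k2 (mulr_ge0 e0 (lE _ kn))).
    by apply: tame_le T => //; rewrite big_ord1 /=; lra.
  - by rewrite (cross_end _ _ (G (Fo 0%N))) u0 mul0r addr0 rot010 mulmx1 -h1 opprB.
  - by rewrite (cross_end _ _ (G (Fo' 0%N))) u1 mul1r add0r -h2 opprB.
have [c [Tc c0 c1]] := IH (ltnW kn).
have [h1 [l' [th [h2 h3]]]] := hc _ kn; have [l0 hl0] := hl _ kn.
have [g1 [t [ph [g2 g3]]]] := hs k.+1 kn.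
have b0 : 0 <= 2 * kap 32 H * (eps * \sum_(i < k.+1) l i * twocosh (i%:R - s)) +
    k%:R * (4 * kap 32 H * (eps / RR)).
  apply: addr_ge0; last exact: mulr_ge0 (ler0n _ _) b1.
  apply: (mulr_ge0 k2 (mulr_ge0 e0 _)); apply: sumr_ge0 => i _; apply: lE.
  exact: leq_trans (ltn_ord i) (ltnW kn).
have T1 := tame_sliding N0 b0 g3 hH Tc.
have T2 := tame_crossing N0 (addr_ge0 b0 b1) l0 e1 h3 hl0 T1.
have u0 : l k.+1 + 0 * (l' - l k.+1) = l k.+1 by ring.
have u1 : l k.+1 + 1 * (l' - l k.+1) = l' by ring.
exists (fun v => c v *m Adb 0 (boost i1 (0 + v * (t - 1))) *m Adb 0 (rot i0 i2 (0 + v * ph))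
  *m Adb (k.+1%:R - s) (boost i2 (l k.+1 + v * (l' - l k.+1))) *m
  Adb (k.+1%:R - s) (rot i0 i1 (0 + v * th))); split.
- have b2 := addr_ge0 (addr_ge0 b0 b1) (mulr_ge0 k2 (mulr_ge0 e0 (lE _ kn))).
  apply: tame_le T2 => //.
    by rewrite (big_ord_recr k.+1) /= -(natr1 k); lra.
  by rewrite (big_ord_recr k.+1) /= -(natr1 k); lra.
- have h := slide_end (boost i1 (0 + 0 * (t - 1))) (rot i0 i2 (0 + 0 * ph)) c0.
  (* The reference slide of length 1 is not a factor of the curve: it is absorbed by the change of
     conjugating position from [k%:R - s] to [k.+1%:R - s]. *)
  have e : Fi k.+1 *m boost i1 (s - k%:R) *m boost i1 (0 + 0 * (t - 1)) *m
      rot i0 i2 (0 + 0 * ph) = Fo k.+1 *m boost i1 (- (k.+1%:R - s)).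
    rewrite !mul0r !addr0 boost10 rot020 !mulmx1 g1 -mulmxA -boost1D.
    by congr (_ *m boost i1 _); rewrite -natr1; ring.
  by rewrite (cross_end _ _ (etrans h e)) u0 mul0r addr0 rot010 mulmx1 -h1 opprB.
- have h := slide_end (boost i1 (0 + 1 * (t - 1))) (rot i0 i2 (0 + 1 * ph)) c1.
  have e : Fi' k.+1 *m boost i1 (s - k%:R) *m boost i1 (0 + 1 * (t - 1)) *m
      rot i0 i2 (0 + 1 * ph) = Fo' k.+1 *m boost i1 (- (k.+1%:R - s)).
    rewrite g2 !mul1r !add0r -!mulmxA; congr (_ *m _).
    (* The rotation is about the axis of translation, so it commutes past the boosts and the
       translation lengths add up. *)
    rewrite -boost1_rot02 !mulmxA -!boost1D; congr (boost i1 _ *m _).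
    by rewrite -natr1; ring.
  by rewrite (cross_end _ _ (etrans h e)) u1 mul1r add0r -h2 opprB.
Qed.

End Chain.

(** * Uniform comparison of the two sequences *)

Section Comparison.
Context {R : realType}.
Implicit Types (s t x y : R).

Lemma chain_estimates (m : nat) (RR B C eps s t : R) (l : nat -> R)
    (Fo Fi Fo' Fi' : nat -> 'M[R]_4) (r r' : 'M[R]_4) :
  0 < B -> isomG (Fo 0%N) -> isomG r -> r i3 i3 = 1 -> isomG r' -> r' i3 i3 = 1 ->
  matched_slide RR eps m.+1 Fo Fi Fo' Fi' -> matched_cross eps m.+1 l Fo Fi Fo' Fi' ->
  (forall i, (i < m.+1)%N -> B^-1 < l i * expR (RR / 2)) ->
  arr (Fo 0%N *m boost i1 s *m r) (Fi m.+1 *m boost i1 t *m r') i3 i3 <= C ->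
  [/\ twocosh (t - (s - m%:R)) <= 4 * C,
      \sum_(i < m.+1) l i * twocosh (i%:R - s) <= 4 * C ^+ 2 &
      m%:R <= RR + (B * (4 * C ^+ 2)) ^+ 2].
Proof.
move=> B0 iF ir r33 ir' r33' hs hc hl hC.
set u := _ *m r in hC; set v := _ *m r' in hC.
have l0 k : (k < m.+1)%N -> 0 < l k.
  move=> /hl h; have : 0 < l k * expR (RR / 2) by apply: lt_trans h; rewrite invr_gt0.
  by rewrite pmulr_lgt0 // expR_gt0.
(* [G k] is the frame on geodesic [k] at the position corresponding to [s]: after [j] unit slides,
   it has offset [s - j] from the foot of the crossing that enters geodesic [j.+1]. *)
pose G k := if k is j.+1 then Fi j.+1 *m boost i1 (s - j%:R) else Fo 0%N *m boost i1 s.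
pose Q k := Adb (k%:R - s) (boost i2 (l k)).
have GS k : (k < m.+1)%N -> G k.+1 = G k *m Q k.
  move=> kn; have [h1 _] := hc k kn; rewrite /G /Q h1 /Adb opprB !mulmxA.
  congr (_ *m _ *m _); case: k kn {h1} => [|k] kn.
    by rewrite -mulmxA -boost1D sub0r subrr boost10 mulmx1.
  have [-> _] := hs k.+1 kn; rewrite -mulmxA -boost1D; congr (_ *m boost i1 _).
  by rewrite -natr1; ring.
have iQ k : isomG (Q k).
  exact: isomG_mul (isomG_mul (isomG_boost1 _) (isomG_boost2 _)) (isomG_boost1 _).
have iG k : (k <= m.+1)%N -> isomG (G k).
  elim: k => [|k IH] kn; first by apply: isomG_mul => //; exact: isomG_boost1.
  by rewrite GS //; apply: isomG_mul => //; apply: IH; exact: ltnW.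
(* The base point of [v] seen from [G k]. It lies on the translation axis for [k = m.+1], and for
   [k = 0] it is controlled by the displacement from [u] to [v]. *)
pose z k := invmx (G k) *m col i3 v.
have zS k : (k < m.+1)%N -> 0 <= l k /\ z k = Q k *m z k.+1.
  move=> kn; split; first exact/ltW/l0.
  have uG := isomG_unit (iG k (ltnW kn)); have uG1 := isomG_unit (iG _ kn).
  rewrite /z -{1}(mulKVmx uG1 (col i3 v)) {1}GS // -!mulmxA (mulmxA (invmx _)).
  by rewrite mulVmx // mul1mx.
pose y := t - (s - m%:R).
have iG0 := iG 0%N isT.
have z0E : z 0%N = col i3 (r *m arr u v).
  have iu : u = G 0%N *m r by [].
  have uu : u \in unitmx by rewrite iu; exact/isomG_unit/isomG_mul.
  rewrite /z /arr mulmxA [RHS]colE -mulmxA -colE; congr (_ *m _).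
  have : G 0%N *m (r *m invmx u) = 1%:M by rewrite mulmxA -iu mulmxV.
  move=> e; rewrite -[RHS]mul1mx -(mulVmx (isomG_unit iG0)) -mulmxA e mulmx1 //.
have iv : v = G m.+1 *m boost i1 y *m r'.
  by rewrite /G -(mulmxA (Fi _)) -boost1D addrC subrK.
have ivv : isomG v.
  by rewrite iv; exact: isomG_mul (isomG_mul (iG _ (leqnn _)) (isomG_boost1 _)) ir'.
have iw : isomG (r *m arr u v).
  exact: isomG_mul ir (isomG_mul (isomG_invmx (isomG_mul iG0 ir)) ivv).
(* Row 3 of [r] is that of the identity, so multiplying by [r] on the left keeps the lower right
   entry. *)
have w33 : (r *m arr u v) i3 i3 <= C.
  have f0 := (isomG_fix3 ir r33 (_ : i0 != i3)).2.
  have f1 := (isomG_fix3 ir r33 (_ : i1 != i3)).2.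
  have f2 := (isomG_fix3 ir r33 (_ : i2 != i3)).2.
  by rewrite mulmx4 f0 ?f1 ?f2 ?r33 ?ord4_eqE // !mul0r !add0r mul1r.
have cr' : col i3 r' = delta_mx i3 0.
  apply/matrixP => i j; rewrite !mxE (ord1 j) eqxx andbT.
  by have [->|/(isomG_fix3 ir' r33')[-> _]] := eqVneq i i3; rewrite ?r33'.
have znE : z m.+1 = boost i1 y *m delta_mx i3 0.
  have -> : z m.+1 = invmx (G m.+1) *m (G m.+1 *m (boost i1 y *m delta_mx i3 0)).
    by rewrite -cr' colE (mulmxA (boost i1 y)) 2!(mulmxA (G m.+1)) -iv -colE.
  by rewrite mulKmx //; exact/isomG_unit/iG.
have [a1 a2 a3] := boost1_act y (delta_mx i3 0); rewrite -znE in a1 a2 a3.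
have Xd : Xp (delta_mx i3 0 : 'cV[R]_4) = 1 /\ Xm (delta_mx i3 0 : 'cV[R]_4) = 1.
  by rewrite /Xp /Xm !mxE !(eqxx, ord4_eqE) /= addr0 subr0.
rewrite Xd.1 mulr1 in a1; rewrite Xd.2 mulr1 in a2.
have d2 : (delta_mx i3 0 : 'cV[R]_4) i2 0 = 0 by rewrite mxE ord4_eqE.
rewrite d2 in a3.
have zk k : `|z 0%N k 0| <= C.
  by rewrite z0E mxE; apply: le_trans w33; exact: isomG_col3_le.
have [b1 b2] := chain_bound a1 a2 a3 zS (ler_normlW (zk i3)) (ler_normlW (zk i2)) (zk i1).
by split=> //; apply: chain_length b2.
Qed.

(** Here [T] is the weighted sum of crossing lengths and [x] the total sliding error. *)
Lemma error_budget (k S M T eps x : R) : 0 <= k -> 0 <= eps -> eps <= 1 -> 0 <= M ->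
  T <= S -> x <= M * eps ->
  4 * k * T + 4 * k * x <= 4 * k * S + 4 * k * M /\
  2 * k * (eps * T) + 4 * k * x <= (2 * k * S + 4 * k * M) * eps.
Proof.
move=> k0 e0 e1 M0 TS xM.
have kT : k * T <= k * S by rewrite ler_wpM2l.
have kx : k * x <= k * (M * eps) by rewrite ler_wpM2l.
have kM : k * (M * eps) <= k * M by rewrite ler_wpM2l // ler_piMr.
have kTe : k * (eps * T) <= k * (eps * S) by rewrite !ler_wpM2l.
by split; lra.
Qed.

(** The constants are uniform in [m] and [RR]: there are at most [RR + O(1)] slides, each of error
    [eps / RR], so the total sliding error is [O(eps)]. *)
Lemma chain_comparison (B C : R) : 0 < B -> 0 < C -> exists N a b : R,
  [/\ 0 <= N, 0 <= b & forall (m : nat) (RR eps s t : R) (l : nat -> R)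
    (Fo Fi Fo' Fi' : nat -> 'M[R]_4) (r r' : 'M[R]_4),
  1 < RR -> 0 <= eps -> eps <= 1 ->
  isomG (Fo 0%N) -> isomG (Fo' 0%N) -> isomG r -> r i3 i3 = 1 -> isomG r' -> r' i3 i3 = 1 ->
  matched_slide RR eps m.+1 Fo Fi Fo' Fi' -> matched_cross eps m.+1 l Fo Fi Fo' Fi' ->
  (forall i, (i < m.+1)%N -> B^-1 < l i * expR (RR / 2)) ->
  let u := Fo 0%N *m boost i1 s *m r in let v := Fi m.+1 *m boost i1 t *m r' in
  let u' := Fo' 0%N *m boost i1 s *m r in let v' := Fi' m.+1 *m boost i1 t *m r' in
  arr u v i3 i3 <= C ->
  exists c, [/\ tame c N a (b * eps), c 0 = arr u v & c 1 = arr u' v']].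
Proof.
move=> B0 C0.
(* [S] bounds the weighted sum of crossing lengths; [H] dominates both [2 * S] for crossings and 2
   for slides; [M] bounds [m%:R / RR], using [1 < RR]. *)
pose S := 4 * C ^+ 2; pose H := 2 * S + 2; pose M := 1 + (B * S) ^+ 2; pose k := kap 32 H.
have S0 : 0 <= S by rewrite /S mulr_ge0 // sqr_ge0.
have H0 : 0 <= H by rewrite /H; lra.
have k0 : 0 <= k by apply: kap_ge0.
have M0 : 0 <= M by rewrite /M addr_ge0 // sqr_ge0.
(* The outer 16 bounds [r]; [16 * (4 * C)] bounds the final translation [boost i1 y] and the last 16
   bounds [r']. *)
exists (16 * (16 * (4 * C) * 16)), (4 * k * S + 4 * k * M), (2 * k * S + 4 * k * M).
have kS : 0 <= k * S by rewrite mulr_ge0.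
have kM : 0 <= k * M by rewrite mulr_ge0.
split; [lra | lra |].
move=> m RR eps s t l Fo Fi Fo' Fi' r r' RR1 e0 e1 iF iF' ir r33 ir' r33' hs hc hl.
move=> u v u' v' hC.
have [hy hS hm] := chain_estimates B0 iF ir r33 ir' r33' hs hc hl hC.
have RR0 : 0 < RR by lra.
have l0 i : (i < m.+1)%N -> 0 < l i.
  move=> /hl h; have : 0 < l i * expR (RR / 2) by apply: lt_trans h; rewrite invr_gt0.
  by rewrite pmulr_lgt0 // expR_gt0.
have lE i : (i < m.+1)%N -> 0 <= l i * twocosh (i%:R - s).
  by move=> /l0/ltW h; rewrite mulr_ge0 // (le_trans _ (twocosh_ge2 _)).
have hl2 i : (i < m.+1)%N -> 0 <= l i /\ 2 * (l i * twocosh (i%:R - s)) <= H.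
  move=> im; split; first exact/ltW/l0.
  have : l i * twocosh (i%:R - s) <= S.
    apply: le_trans hS; rewrite (bigD1 (Ordinal im)) //= lerDl.
    by apply: sumr_ge0 => j _; apply: lE.
  by rewrite /H; lra.
have dl : eps / RR <= 1 by rewrite ler_pdivrMr // mul1r; lra.
have hH : 2 * (eps / RR) <= H by rewrite /H; lra.
have [c [Tc c0 c1]] := chain_curve ir r33 e0 e1 RR0 hs hc hl2 hH (leqnn m.+1).
set Sm := \sum_(i < m.+1) _ in hS Tc.
have Sm0 : 0 <= Sm by apply: sumr_ge0 => i _; exact: lE.
have md : m%:R * (eps / RR) <= M * eps.
  rewrite mulrCA mulrC ler_wpM2r // ler_pdivrMr // /M mulrDl mul1r.
  apply: (le_trans hm); rewrite lerD2l ler_peMr ?sqr_ge0 //; lra.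
have d0 : 0 <= eps / RR by rewrite divr_ge0 // ltW.
pose y := t - (s - m%:R); pose W := boost i1 y *m r'.
have iW : isomG W by apply: isomG_mul => //; exact: isomG_boost1.
have nW : nm W <= 16 * (4 * C) * 16.
  apply: (le_trans (nmM _ _)); apply: ler_pM; rewrite ?nm_ge0 ?nm_fix3 //.
  by apply: (le_trans (nm_boost1 _)); rewrite ler_wpM2l.
have b0 : 0 <= 2 * k * (eps * Sm) + m%:R * (4 * k * (eps / RR)).
  apply: addr_ge0; first by apply: mulr_ge0; [lra | exact: mulr_ge0].
  by apply: mulr_ge0 => //; apply: mulr_ge0 => //; lra.
have T := tame_mulr_cst iW (ler0n _ 16) b0 Tc.
have FW F : F *m boost i1 (s - m%:R) *m W = F *m boost i1 t *m r'.
  by rewrite /W mulmxA -(mulmxA F) -boost1D /y addrC subrK.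
have iu : isomG u by do !apply: isomG_mul => //; exact: isomG_boost1.
have iu' : isomG u' by do !apply: isomG_mul => //; exact: isomG_boost1.
exists (fun w => c w *m W); split.
- have [ha hb] := error_budget k0 e0 e1 M0 (hS : Sm <= S) md.
  have E : m%:R * (4 * k * (eps / RR)) = 4 * k * (m%:R * (eps / RR)) by rewrite mulrCA.
  apply: tame_le T => //; rewrite ?mulr_ge0 ?nm_ge0 ?ler_wpM2l // E.
    exact: ha.
  exact: hb.
- have -> : v = u *m (c 0 *m W) by rewrite mulmxA /u c0 FW.
  by rewrite /arr mulKmx ?isomG_unit.
- have -> : v' = u' *m (c 1 *m W) by rewrite mulmxA /u' c1 FW.
  by rewrite /arr mulKmx ?isomG_unit.
Qed.

Lemma invmx_arr (u v : 'M[R]_4) : isomG u -> isomG v -> arr v u = jinv (arr u v).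
Proof.
move=> iu iv; have [uu uv] := (isomG_unit iu, isomG_unit iv).
have iw : isomG (arr u v) by apply: isomG_mul => //; exact: isomG_invmx.
have e : arr v u *m arr u v = 1%:M.
  by rewrite /arr mulmxA -(mulmxA _ u) mulmxV // mulmx1 mulVmx.
by rewrite -[LHS]mulmx1 -(mul_isomG_jinv iw) mulmxA e mul1mx.
Qed.

(** Hence the map has no distortion on pairs of frames transformed by the same isometry. *)
Lemma arr_mull (F u v : 'M[R]_4) : F \in unitmx -> u \in unitmx ->
  arr (F *m u) (F *m v) = arr u v.
Proof.
move=> uF uu; rewrite /arr.
have uFu : F *m u \in unitmx by rewrite unitmx_mul uF.
have e : invmx (F *m u) *m F = invmx u.
  by rewrite -[LHS]mulmx1 -(mulmxV uu) mulmxA -(mulmxA _ F) mulVmx // mul1mx.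
by rewrite mulmxA e.
Qed.

End Comparison.

(** * Bounded distortion of the map on frames *)

Theorem theoremA14 (R : realType) (A : 'M[R]_16) (hA : A \in unitmx)
  (B D : R) (hB : 0 < B) (hD : 0 < D) :
  exists K eps0 R0 : R, 0 < K /\ 0 < eps0 /\ 0 < R0 /\
  forall (RR eps : R), R0 < RR -> eps < eps0 ->
  forall (n : nat) (gam gam' eta eta' : nat -> ogeod R)
         (Fo Fi Fo' Fi' : nat -> 'M[R]_4),
    (1 <= n)%N ->
    linear_seq n gam eta ->
    semilinear_seq n gam' eta' ->
    orth_frames n gam eta Fo Fi ->
    orth_frames n gam' eta' Fo' Fi' ->
    well_matched RR B eps n Fo Fi Fo' Fi' ->
    bounded_distortion A (Fr (gam 0%N) `|` Fr (gam n))
      (emap (gam 0%N) (Fo 0%N) (Fo' 0%N) (Fi n) (Fi' n)) (K * eps) D.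
Proof.
have [C1 C10 h33] := gdist_lt_entry33 hA; have [C2 C20 hup] := gdist_tame A.
pose C := expR (C1 * D).
have [N [a [b [N0 b0 cmp]]]] := chain_comparison hB (expR_gt0 (C1 * D) : 0 < C).
pose K0 := C2 * ((N * expR a) ^+ 2 * b).
have K00 : 0 <= K0 by rewrite /K0 mulr_ge0 ?(ltW C20) // mulr_ge0 ?sqr_ge0.
(* [K0 * eps] bounds the length of the interpolating curve; adding 1 makes the inequality strict and
   [K] positive even when [K0] is 0. *)
exists (K0 + 1), 1, 1; split; first lra.
do 2!split=> //.
move=> RR eps RR1 e1 [//|m] gam gam' eta eta' Fo Fi Fo' Fi' _ _ _ hof hof' [hs hc].
have /choice[l hl] : forall i, exists x, (i < m.+1)%N ->
    Fi i.+1 = Fo i *m boost i2 x /\ B^-1 < x * expR (RR / 2) < B /\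
    exists l' th', Fi' i.+1 = Fo' i *m boost i2 l' *m rot i0 i1 th' /\
      cabs (l' - x) th' < eps * x.
  move=> i; case: (boolP (i < m.+1)%N) => [im|_]; last by exists 0.
  by have [x hx] := hc i im; exists x.
have mc : matched_cross eps m.+1 l Fo Fi Fo' Fi'.
  by move=> i /hl[h1 [_ h2]].
have lB i : (i < m.+1)%N -> B^-1 < l i * expR (RR / 2) by move=> /hl[_ [/andP[]]].
have l0 : 0 < l 0%N.
  have : 0 < l 0%N * expR (RR / 2) by apply: lt_trans (lB 0%N isT); rewrite invr_gt0.
  by rewrite pmulr_lgt0 // expR_gt0.
(* Positivity of [eps] is forced by the matching at the first crossing, since [cabs] is nonnegative
   and [l 0] positive. *)
have e0 : 0 < eps.
  have [_ [l' [th [_ h]]]] := mc 0%N isT.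
  have : 0 < eps * l 0%N by apply: le_lt_trans h; exact: sqrtr_ge0.
  by rewrite pmulr_lgt0.
have [[F0 _] _] := hof 0%N isT; have [_ [Fn _]] := hof m (leqnn _).
have [[F0' _] _] := hof' 0%N isT; have [_ [Fn' _]] := hof' m (leqnn _).
have Keps : C2 * ((N * expR a) ^+ 2 * (b * eps)) < (K0 + 1) * eps.
  by rewrite (_ : C2 * _ = K0 * eps) ?ltr_pM2r ?ltrDl // /K0; ring.
have self g : isomG g -> (gdist A g g < ((K0 + 1) * eps)%:E)%E.
  move=> ig; have := hup _ _ _ _ (nm_ge0 g) (lexx 0) (tame_cst ig (lexx _)).
  by move/le_lt_trans; apply; rewrite !mulr0 lte_fin mulr_gt0 //; lra.
pose Eo := Fo' 0%N *m invmx (Fo 0%N); pose En := Fi' m.+1 *m invmx (Fi m.+1).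
have uEo : Eo \in unitmx.
  by apply/isomG_unit/isomG_mul; [exact: F0'.1 | exact/isomG_invmx/F0.1].
have uEn : En \in unitmx.
  by apply/isomG_unit/isomG_mul; [exact: Fn'.1 | exact/isomG_invmx/Fn.1].
have cross u v : Fr (gam 0%N) u -> Fr (gam m.+1) v -> arr u v i3 i3 <= C ->
    exists c, [/\ tame c N a (b * eps), c 0 = arr u v & c 1 = arr (Eo *m u) (En *m v)].
  move=> /(Fr_decomp F0)[s [r [-> ir r33]]] /(Fr_decomp Fn)[t [r' [-> ir' r33']]] h.
  have := cmp m RR eps s t l Fo Fi Fo' Fi' r r' RR1 (ltW e0) (ltW e1) F0.1 F0'.1
    ir r33 ir' r33' hs mc lB h.
  rewrite /Eo /En -!(mulmxA (Fo' 0%N)) -!(mulmxA (Fi' m.+1)).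
  by rewrite -!(mulmxA (Fo 0%N)) -!(mulmxA (Fi m.+1)) !mulKmx //; apply: isomG_unit;
    [exact: Fn.1 | exact: F0.1].
move=> u v Xu Xv /h33 hC; rewrite -/C in hC.
have iu : isomG u by case: Xu => [] [].
have iv : isomG v by case: Xv => [] [].
have iuv : isomG (arr u v) by apply: isomG_mul => //; exact: isomG_invmx.
(* When both frames are moved by the same isometry the arrow is unchanged. The mixed cases use the
   curve from [cross], inverted when [u] lies on the last geodesic. *)
rewrite /emap; case: asboolP => [u0|nu]; case: asboolP => [v0|nv].
- by rewrite (arr_mull _ uEo (isomG_unit iu)); exact: self.
- case: Xv => // vn; have [c [Tc c0 c1]] := cross u v u0 vn hC.
  rewrite -c0 -c1; apply: le_lt_trans (hup _ _ _ _ N0 _ Tc) _.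
    by rewrite mulr_ge0 // ltW.
  by rewrite lte_fin.
- case: Xu => // un; have hC' : arr v u i3 i3 <= C by rewrite invmx_arr // jinv33.
  have [c [Tc c0 c1]] := cross v u v0 un hC'.
  rewrite (invmx_arr iv iu) -c0 (@invmx_arr _ (Eo *m v)) //.
  + rewrite -c1; apply: le_lt_trans (hup _ _ _ _ N0 _ (tame_jinv Tc)) _.
      by rewrite mulr_ge0 // ltW.
    by rewrite lte_fin.
  + by apply: isomG_mul => //; apply: isomG_mul; [exact: F0'.1 | exact/isomG_invmx/F0.1].
  + by apply: isomG_mul => //; apply: isomG_mul; [exact: Fn'.1 | exact/isomG_invmx/Fn.1].
- by rewrite (arr_mull _ uEn (isomG_unit iu)); exact: self.
Qed.
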